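(* The algebra $U_{r,s}(\mathfrak{sl}_\infty)$ has a triangular decomposition $$U_{r,s}(\mathfrak{sl}_\infty)\cong U^-_{r,s}(\mathfrak{sl}_\infty)\otimes U^0_{r,s}(\mathfrak{sl}_\infty)\otimes U^+_{r,s}(\mathfrak{sl}_\infty),$$ i.e. the multiplication map from the right-hand side (tensor products over $\mathbb{Q}(r,s)$) to the left-hand side is an isomorphism of $\mathbb{Q}(r,s)$-vector spaces.
   Context: $\mathbb{N}=\{1,2,3,\dots\}$, and $\mathbb{Q}(r,s)$ is the field of rational functions in two independent variables $r,s$. On the free abelian group with basis $\alpha_i$ ($i\in\mathbb{N}$) let $\langle-,-\rangle$ be the bilinear form with $\langle i,j\rangle:=\langle\alpha_i,\alpha_j\rangle$ equal to $1$ if $i=j$, $-1$ if $j=i+1$, and $0$ otherwise. $U_{r,s}(\mathfrak{sl}_\infty)$ is the unital associative $\mathbb{Q}(r,s)$-algebra generated by $e_i,f_i,w_i^{\pm1},w_i'^{\pm1}$ ($i\in\mathbb{N}$) subject to the relations: - all $w_i^{\pm1},w_j'^{\pm1}$ commute with each other, $w_i^{\pm1}w_i^{\mp1}=1=w_i'^{\pm1}w_i'^{\mp1}$; - $w_ie_j=r^{\langle j,i\rangle}s^{-\langle i,j\rangle}e_jw_i$, $\;w_i'e_j=r^{-\langle i,j\rangle}s^{\langle j,i\rangle}e_jw_i'$; - $w_if_j=r^{-\langle j,i\rangle}s^{\langle i,j\rangle}f_jw_i$, $\;w_i'f_j=r^{\langle i,j\rangle}s^{-\langle j,i\rangle}f_jw_i'$;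 - $e_if_j-f_je_i=\delta_{i,j}\dfrac{w_i-w_i'}{r-s}$; - $e_ie_j-e_je_i=f_if_j-f_jf_i=0$ for $|i-j|>1$; - $e_i^2e_{i+1}-(r+s)e_ie_{i+1}e_i+rs\,e_{i+1}e_i^2=0$, $\;e_ie_{i+1}^2-(r+s)e_{i+1}e_ie_{i+1}+rs\,e_{i+1}^2e_i=0$; - $f_i^2f_{i+1}-(r^{-1}+s^{-1})f_if_{i+1}f_i+(rs)^{-1}f_{i+1}f_i^2=0$, $\;f_if_{i+1}^2-(r^{-1}+s^{-1})f_{i+1}f_if_{i+1}+(rs)^{-1}f_{i+1}^2f_i=0$. $U^+_{r,s}(\mathfrak{sl}_\infty)$, $U^-_{r,s}(\mathfrak{sl}_\infty)$, $U^0_{r,s}(\mathfrak{sl}_\infty)$ are the subalgebras generated by all $e_i$, by all $f_i$, and by all $w_i^{\pm1},w_i'^{\pm1}$, respectively. *)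

(* Defs.v *)
From HB Require Import structures.
From mathcomp Require Import all_boot all_order all_algebra.
From mathcomp Require Import finmap boolp.
From mathcomp.multinomials Require mpoly.
From mathcomp.multinomials Require Import monalg.

Set Implicit Arguments.
Unset Strict Implicit.
Unset Printing Implicit Defensive.

Import GRing.Theory Num.Theory.
Import Quotient.
Local Open Scope ring_scope.
Local Open Scope quotient_scope.

Section RationalFunctions.
(* Imported only here: several names and notations of [mpoly] clash with those
   of [monalg]. *)
Import mpoly.

Definition Qrs : fieldType := {fraction (mpoly 2 rat)}.
Definition Qr : Qrs := tofrac (mpolyX rat (mnm1 (0 : 'I_2))).
Definition Qs : Qrs := tofrac (mpolyX rat (mnm1 (1 : 'I_2))).

End RationalFunctions.

Section SpanQuotient.
Variables (K : fieldType) (V : lmodType K) (S : V -> Prop).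

Inductive in_span : V -> Prop :=
  | in_span_gen x of S x : in_span x
  | in_span0 : in_span 0
  | in_spanD x y of in_span x & in_span y : in_span (x + y)
  | in_spanZ a x of in_span x : in_span (a *: x).

(* Membership is made boolean by the classical axioms of boolp, as required by
   the quotient construction. *)
Definition spanp : {pred V} := fun x => `[< in_span x >].

Lemma spanpP x : reflect (in_span x) (x \in spanp).
Proof. exact: asboolP. Qed.

Lemma spanp_submod : GRing.submod_closed spanp.
Proof.
split=> [|a x y /spanpP xS /spanpP yS]; apply/spanpP; first exact: in_span0.
by apply: in_spanD => //; apply: in_spanZ.
Qed.

HB.instance Definition _ := GRing.isSubmodClosed.Build K V spanp spanp_submod.

Definition span_quot : Type := {quot (spanp : zmodClosed V)}.
HB.instance Definition _ := GRing.Zmodule.on span_quot.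

Definition span_pi : V -> span_quot := \pi_{quot (spanp : zmodClosed V)}.

Lemma span_pi_eq x y : (span_pi x == span_pi y) = (x - y \in spanp).
Proof. by rewrite /span_pi -idealrBE. Qed.

Lemma span_piK (q : span_quot) : span_pi (repr q) = q.
Proof. exact: reprK. Qed.

Lemma span_pi_zmod : zmod_morphism span_pi.
Proof. exact: (raddfB \pi_{quot (spanp : zmodClosed V)}). Qed.

HB.instance Definition _ :=
  GRing.isZmodMorphism.Build V span_quot span_pi span_pi_zmod.

Definition span_scale (a : K) (q : span_quot) : span_quot :=
  span_pi (a *: repr q).

Lemma span_pi_scale a x : span_scale a (span_pi x) = span_pi (a *: x).
Proof.
apply/eqP; rewrite span_pi_eq -scalerBr; apply: rpredZ.
by rewrite -span_pi_eq span_piK.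
Qed.

Lemma span_scaleA a b q : span_scale a (span_scale b q) = span_scale (a * b) q.
Proof. by rewrite -[q]span_piK !span_pi_scale scalerA. Qed.

Lemma span_scale1 : left_id 1 span_scale.
Proof. by move=> q; rewrite -[q]span_piK span_pi_scale scale1r. Qed.

Lemma span_scaleDr : right_distributive span_scale +%R.
Proof.
move=> a p q; rewrite -[p]span_piK -[q]span_piK -raddfD !span_pi_scale.
by rewrite scalerDr raddfD.
Qed.

Lemma span_scaleDl q : {morph span_scale^~ q : a b / a + b}.
Proof.
by move=> a b; rewrite -[q]span_piK !span_pi_scale scalerDl raddfD.
Qed.

HB.instance Definition _ := GRing.Zmodule_isLmodule.Build K span_quot
  span_scaleA span_scale1 span_scaleDr span_scaleDl.

Lemma span_pi_scalable : scalable span_pi.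
Proof. by move=> a x; rewrite -span_pi_scale. Qed.

HB.instance Definition _ :=
  GRing.isScalable.Build K V span_quot *:%R span_pi span_pi_scalable.

End SpanQuotient.

Section Presentation.
Variables (K : fieldType) (A : algType K) (R : A -> A -> Prop).

Definition ideal_gen (z : A) : Prop :=
  exists a x y b, R x y /\ z = a * (x - y) * b.

(* The span of all [a * (x - y) * b] with [R x y] is the two-sided ideal
   generated by the differences [x - y]. *)
Definition pres : Type := span_quot ideal_gen.
HB.instance Definition _ := GRing.Lmodule.on pres.

Definition pres_pi : A -> pres := span_pi ideal_gen.
HB.instance Definition _ := GRing.Linear.on pres_pi.

Lemma ideal_mull a x :
  x \in spanp ideal_gen -> a * x \in spanp ideal_gen.
Proof.
move=> /spanpP; elim=> {x} [_ [c [x [y [b [Rxy ->]]]]]||x y _ ? _ ?|c x _ ?].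
- by apply/spanpP/in_span_gen; exists (a * c), x, y, b; rewrite !mulrA.
- by rewrite mulr0 rpred0.
- by rewrite mulrDr rpredD.
- by rewrite -scalerAr rpredZ.
Qed.

Lemma ideal_mulr a x :
  x \in spanp ideal_gen -> x * a \in spanp ideal_gen.
Proof.
move=> /spanpP; elim=> {x} [_ [c [x [y [b [Rxy ->]]]]]||x y _ ? _ ?|c x _ ?].
- by apply/spanpP/in_span_gen; exists c, x, y, (b * a); rewrite !mulrA.
- by rewrite mul0r rpred0.
- by rewrite mulrDl rpredD.
- by rewrite -scalerAl rpredZ.
Qed.

Definition pres_mul (p q : pres) : pres := pres_pi (repr p * repr q).

Lemma pres_piK (q : pres) : pres_pi (repr q) = q.
Proof. exact: span_piK. Qed.

Lemma pres_pi_mul x y : pres_mul (pres_pi x) (pres_pi y) = pres_pi (x * y).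
Proof.
have reprB z : repr (pres_pi z) - z \in spanp ideal_gen.
  by rewrite -span_pi_eq span_piK.
apply/eqP; rewrite span_pi_eq.
rewrite -[X in X - _](subrK (x * repr (pres_pi y))) -mulrBl -addrA -mulrBr.
by apply: rpredD; [apply: ideal_mulr|apply: ideal_mull].
Qed.

Lemma pres_mulA : associative pres_mul.
Proof.
move=> p q t; rewrite -[p]pres_piK -[q]pres_piK -[t]pres_piK !pres_pi_mul.
by rewrite mulrA.
Qed.

Lemma pres_mul1l : left_id (pres_pi 1) pres_mul.
Proof. by move=> p; rewrite -[p]pres_piK pres_pi_mul mul1r. Qed.

Lemma pres_mul1r : right_id (pres_pi 1) pres_mul.
Proof. by move=> p; rewrite -[p]pres_piK pres_pi_mul mulr1. Qed.

Lemma pres_mulDl : left_distributive pres_mul +%R.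
Proof.
move=> p q t; rewrite -[p]pres_piK -[q]pres_piK -[t]pres_piK.
by rewrite -raddfD !pres_pi_mul mulrDl raddfD.
Qed.

Lemma pres_mulDr : right_distributive pres_mul +%R.
Proof.
move=> p q t; rewrite -[p]pres_piK -[q]pres_piK -[t]pres_piK.
by rewrite -raddfD !pres_pi_mul mulrDr raddfD.
Qed.

HB.instance Definition _ := GRing.Zmodule_isPzRing.Build pres
  pres_mulA pres_mul1l pres_mul1r pres_mulDl pres_mulDr.

Lemma pres_pi_monoid : monoid_morphism pres_pi.
Proof. by split=> // x y; rewrite -pres_pi_mul. Qed.

HB.instance Definition _ :=
  GRing.isMonoidMorphism.Build A pres pres_pi pres_pi_monoid.

Lemma pres_scaleAl (a : K) (p q : pres) : a *: (p * q) = (a *: p) * q.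
Proof.
by rewrite -[p]pres_piK -[q]pres_piK -rmorphM -!linearZ -rmorphM scalerAl.
Qed.

Lemma pres_scaleAr (a : K) (p q : pres) : a *: (p * q) = p * (a *: q).
Proof.
by rewrite -[p]pres_piK -[q]pres_piK -rmorphM -!linearZ -rmorphM scalerAr.
Qed.

Lemma pres_rel x y : R x y -> pres_pi x = pres_pi y.
Proof.
move=> Rxy; apply/eqP; rewrite span_pi_eq; apply/spanpP/in_span_gen.
by exists 1, x, y, 1; rewrite mul1r mulr1.
Qed.

End Presentation.

Section Subalgebra.
Variables (K : fieldType) (A : algType K) (S : A -> Prop).

Inductive in_subalg : A -> Prop :=
  | in_subalg_gen x of S x : in_subalg x
  | in_subalg1 : in_subalg 1
  | in_subalgD x y of in_subalg x & in_subalg y : in_subalg (x + y)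
  | in_subalgZ a x of in_subalg x : in_subalg (a *: x)
  | in_subalgM x y of in_subalg x & in_subalg y : in_subalg (x * y).

Definition subalgp : {pred A} := fun x => `[< in_subalg x >].

Lemma subalgpP x : reflect (in_subalg x) (x \in subalgp).
Proof. exact: asboolP. Qed.

Lemma subalgp_closed : GRing.subalg_closed subalgp.
Proof.
split=> [|a x y /subalgpP xS /subalgpP yS|x y /subalgpP xS /subalgpP yS];
  apply/subalgpP; first exact: in_subalg1.
  by apply: in_subalgD => //; apply: in_subalgZ.
exact: in_subalgM.
Qed.

HB.instance Definition _ := GRing.isSubalgClosed.Build K A subalgp subalgp_closed.

Definition subalg : Type := {x : A | x \in subalgp}.
HB.instance Definition _ := SubChoice.on subalg.
HB.instance Definition _ := [SubChoice_isSubLalgebra of subalg by <:].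
HB.instance Definition _ := [SubLalgebra_isSubAlgebra of subalg by <:].

End Subalgebra.

Section Tensor.
Variables (K : fieldType) (V W : lmodType K).

(* The vector space with basis the set [V * W]. *)
Definition free_pairs := {malg K[(V * W)%type]}.
HB.instance Definition _ := GRing.Lmodule.on free_pairs.

Definition pair_basis (v : V) (w : W) : free_pairs := << (v, w) >>.

Inductive tensor_rel : free_pairs -> Prop :=
  | tensor_relDl v v' w :
      tensor_rel (pair_basis (v + v') w - pair_basis v w - pair_basis v' w)
  | tensor_relDr v w w' :
      tensor_rel (pair_basis v (w + w') - pair_basis v w - pair_basis v w')
  | tensor_relZl a v w :
      tensor_rel (pair_basis (a *: v) w - a *: pair_basis v w)
  | tensor_relZr a v w :
      tensor_rel (pair_basis v (a *: w) - a *: pair_basis v w).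

Definition tensor : Type := span_quot tensor_rel.
HB.instance Definition _ := GRing.Lmodule.on tensor.

Definition tens (v : V) (w : W) : tensor := span_pi tensor_rel (pair_basis v w).

Section Lift.
Variables (X : lmodType K) (f : {bilinear V -> W -> X}).

Definition free_lift (g : free_pairs) : X :=
  \sum_(k <- msupp g) g@_k *: f k.1 k.2.

Lemma free_liftEw (d : {fset V * W}) g : (msupp g `<=` d)%fset ->
  free_lift g = \sum_(k <- d) g@_k *: f k.1 k.2.
Proof.
move=> le; rewrite [LHS](big_fset_incl _ le) => //= x xd /mcoeff_outdom ->.
by rewrite scale0r.
Qed.

Lemma free_lift_linear : linear free_lift.
Proof.
move=> a x y; pose d := (msupp x `|` msupp y `|` msupp (a *: x + y))%fset.
have xd : (msupp x `<=` d)%fset by rewrite /d -fsetUA fsubsetUl.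
have yd : (msupp y `<=` d)%fset by rewrite /d fsetUAC fsubsetUr.
have zd : (msupp (a *: x + y) `<=` d)%fset by rewrite /d fsubsetUr.
rewrite (free_liftEw xd) (free_liftEw yd) (free_liftEw zd).
rewrite scaler_sumr -big_split; apply: eq_bigr => k _ /=.
by rewrite mcoeffD mcoeffZ scalerDl scalerA.
Qed.

HB.instance Definition _ :=
  GRing.isLinear.Build K free_pairs X *:%R free_lift free_lift_linear.

Lemma free_lift_basis v w : free_lift (pair_basis v w) = f v w.
Proof.
by rewrite (free_liftEw msuppU_le) big_seq_fset1 mcoeffUU scale1r.
Qed.

Lemma free_lift_span g : g \in spanp tensor_rel -> free_lift g = 0.
Proof.
move=> /spanpP; elim=> {g} [g Rg||x y _ IHx _ IHy|a x _ IHx].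
- case: Rg => [v v' w|v w w'|a v w|a v w].
  + by rewrite !linearB /= !free_lift_basis linearDl /= addrAC addrK subrr.
  + by rewrite !linearB /= !free_lift_basis linearDr /= addrAC addrK subrr.
  + by rewrite linearB linearZ /= !free_lift_basis linearZl_LR subrr.
  + by rewrite linearB linearZ /= !free_lift_basis linearZr_LR subrr.
- exact: linear0.
- by rewrite linearD /= IHx IHy addr0.
- by rewrite linearZ /= IHx scaler0.
Qed.

Definition tensor_lift (t : tensor) : X := free_lift (repr t).

Lemma tensor_lift_pi g : tensor_lift (span_pi tensor_rel g) = free_lift g.
Proof.
apply/eqP; rewrite -subr_eq0 -linearB; apply/eqP/free_lift_span.
by rewrite -span_pi_eq span_piK.
Qed.

Lemma tensor_lift_linear : linear tensor_lift.
Proof.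
move=> a p q; rewrite -[p]span_piK -[q]span_piK -linearP !tensor_lift_pi.
by rewrite linearP.
Qed.

HB.instance Definition _ :=
  GRing.isLinear.Build K tensor X *:%R tensor_lift tensor_lift_linear.

Lemma tensor_liftE v w : tensor_lift (tens v w) = f v w.
Proof. by rewrite tensor_lift_pi free_lift_basis. Qed.

End Lift.
End Tensor.

Section Multiplication.
Variables (K : fieldType) (A : algType K) (S1 S2 S3 : A -> Prop).

Definition mul2 (x : subalg S1) (y : subalg S2) : A := val x * val y.

Lemma mul2_bilinear : bilinear_for *:%R *:%R mul2.
Proof.
split=> [y|x] a u v; rewrite /= /mul2 linearP.
  by rewrite mulrDl -scalerAl.
by rewrite mulrDr -scalerAr.
Qed.

HB.instance Definition _ := bilinear_isBilinear.Build K
  (subalg S1) (subalg S2) A *:%R *:%R mul2 mul2_bilinear.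

Definition mul3 (t : tensor (subalg S1) (subalg S2)) (z : subalg S3) : A :=
  tensor_lift mul2 t * val z.

Lemma mul3_bilinear : bilinear_for *:%R *:%R mul3.
Proof.
split=> [y|x] a u v; rewrite /= /mul3 linearP.
  by rewrite mulrDl -scalerAl.
by rewrite mulrDr -scalerAr.
Qed.

HB.instance Definition _ := bilinear_isBilinear.Build K
  (tensor (subalg S1) (subalg S2)) (subalg S3) A *:%R *:%R mul3 mul3_bilinear.

Definition mult_map : tensor (tensor (subalg S1) (subalg S2)) (subalg S3) -> A :=
  tensor_lift mul3.

HB.instance Definition _ := GRing.Linear.on mult_map.

Lemma mult_mapE x y z :
  mult_map (tens (tens x y) z) = val x * val y * val z.
Proof. by rewrite /mult_map tensor_liftE /= /mul3 tensor_liftE. Qed.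

End Multiplication.

(* [Gwi] and [Gwi'] stand for the inverses of [Gw] and [Gw'].  The index set
   {1, 2, ...} is renumbered as {0, 1, ...}: the relations only involve the
   difference of two indices. *)
Inductive gen := Ge of nat | Gf of nat
  | Gw of nat | Gwi of nat | Gw' of nat | Gwi' of nat.

Definition gen_code (g : gen) : nat * nat :=
  match g with
  | Ge i => (0, i) | Gf i => (1, i) | Gw i => (2, i)
  | Gwi i => (3, i) | Gw' i => (4, i) | Gwi' i => (5, i)
  end%N.

Definition gen_decode (c : nat * nat) : option gen :=
  match c with
  | (0, i) => Some (Ge i) | (1, i) => Some (Gf i) | (2, i) => Some (Gw i)
  | (3, i) => Some (Gwi i) | (4, i) => Some (Gw' i) | (5, i) => Some (Gwi' i)
  | _ => None
  end%N.

Lemma gen_codeK : pcancel gen_code gen_decode.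
Proof. by case. Qed.

HB.instance Definition _ := Countable.copy gen (pcan_type gen_codeK).

Definition is_w (g : gen) : bool :=
  match g with Ge _ | Gf _ => false | _ => true end.

(* The values of the bilinear form on the basis elements. *)
Definition form (i j : nat) : int :=
  if i == j then 1 else if j == i.+1 then -1 else 0.

Section Relations.
Variables (K : fieldType) (r s : K) (A : algType K) (v : gen -> A).

Local Notation e i := (v (Ge i)).
Local Notation f i := (v (Gf i)).
Local Notation w i := (v (Gw i)).
Local Notation wi i := (v (Gwi i)).
Local Notation w' i := (v (Gw' i)).
Local Notation wi' i := (v (Gwi' i)).

(* [U_rel x y] is the relation [x = y] required of a family [v] of elements of
   [A] indexed by the generators. *)
Inductive U_rel : A -> A -> Prop :=
  | rel_comm g h of is_w g & is_w h :
      U_rel (v g * v h) (v h * v g)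
  | rel_wwi i : U_rel (w i * wi i) 1
  | rel_wiw i : U_rel (wi i * w i) 1
  | rel_wwi' i : U_rel (w' i * wi' i) 1
  | rel_wiw' i : U_rel (wi' i * w' i) 1
  | rel_we i j :
      U_rel (w i * e j) ((r ^ form j i * s ^ (- form i j)) *: (e j * w i))
  | rel_w'e i j :
      U_rel (w' i * e j) ((r ^ (- form i j) * s ^ form j i) *: (e j * w' i))
  | rel_wf i j :
      U_rel (w i * f j) ((r ^ (- form j i) * s ^ form i j) *: (f j * w i))
  | rel_w'f i j :
      U_rel (w' i * f j) ((r ^ form i j * s ^ (- form j i)) *: (f j * w' i))
  | rel_ef i j :
      U_rel (e i * f j - f j * e i)
            (if i == j then (r - s)^-1 *: (w i - w' i) else 0)
  | rel_ee i j of 1 < `|i%:Z - j%:Z| : U_rel (e i * e j - e j * e i) 0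
  | rel_ff i j of 1 < `|i%:Z - j%:Z| : U_rel (f i * f j - f j * f i) 0
  | rel_serre_e1 i :
      U_rel (e i ^+ 2 * e i.+1 - (r + s) *: (e i * e i.+1 * e i)
             + (r * s) *: (e i.+1 * e i ^+ 2)) 0
  | rel_serre_e2 i :
      U_rel (e i * e i.+1 ^+ 2 - (r + s) *: (e i.+1 * e i * e i.+1)
             + (r * s) *: (e i.+1 ^+ 2 * e i)) 0
  | rel_serre_f1 i :
      U_rel (f i ^+ 2 * f i.+1 - (r^-1 + s^-1) *: (f i * f i.+1 * f i)
             + (r * s)^-1 *: (f i.+1 * f i ^+ 2)) 0
  | rel_serre_f2 i :
      U_rel (f i * f i.+1 ^+ 2 - (r^-1 + s^-1) *: (f i.+1 * f i * f i.+1)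
             + (r * s)^-1 *: (f i.+1 ^+ 2 * f i)) 0.

(* The counit [e_i, f_i |-> 0], [w_i, w'_i |-> 1] is used to show that the
   algebra defined below is nonzero. *)
Definition counit_gen (g : gen) : K := (is_w g)%:R.

Lemma counit_rel (phi : {rmorphism A -> K}) x y :
    (forall a x, phi (a *: x) = a * phi x) ->
    (forall g, phi (v g) = counit_gen g) ->
  U_rel x y -> phi x = phi y.
Proof.
move=> phiZ phiv; pose E := (rmorphD, rmorphN, rmorphM, rmorphXn, rmorph0).
case=> *; rewrite ?[phi (if _ then _ else _)]fun_if ?(E, rmorph1, phiZ) /=.
all: rewrite ?phiZ ?E ?phiv /counit_gen ?rmorph1 /=.
all: rewrite ?(expr2, mulr0, mul0r, mulr1, subrr, addr0, if_same) //.
exact: mulrC.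
Qed.

End Relations.

Section FreeAlgebra.
Variable K : fieldType.

Definition free_gen := {malg K[{fmonom gen}]}.
HB.instance Definition _ := GRing.Lalgebra.on free_gen.

Lemma free_gen_scaleAr (a : K) (x y : free_gen) : a *: (x * y) = x * (a *: y).
Proof.
have aC : a%:MP * x = x * a%:MP :> free_gen.
  rewrite mul_malgC malgZ_def [RHS]malgM_def fgmulgU /fgscale.
  by apply: eq_bigr => k _; rewrite mulrC mulm1.
transitivity (a%:MP * (x * y)); first by rewrite mul_malgC.
by rewrite mulrA aC -mulrA; congr (_ * _); exact: mul_malgC.
Qed.

HB.instance Definition _ :=
  GRing.Lalgebra_isAlgebra.Build K free_gen free_gen_scaleAr.

Definition var (g : gen) : free_gen := << fmu g >>.

End FreeAlgebra.

Section QuantumGroup.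
Variables (K : fieldType) (r s : K).

Definition U : Type := pres (U_rel r s (@var K)).
HB.instance Definition _ := GRing.PzRing.on U.
HB.instance Definition _ := GRing.Lmodule.on U.

Definition counit_monom (m : {fmonom gen}) : K := \prod_(g <- m) counit_gen K g.

Lemma counit_monomP : mmorphism counit_monom.
Proof.
split=> [x y|]; rewrite /counit_monom; last by rewrite fm1 big_nil.
by rewrite fmM big_cat.
Qed.

HB.instance Definition _ :=
  isMultiplicative.Build {fmonom gen} K counit_monom counit_monomP.

Definition counit : free_gen K -> K := mmap idfun counit_monom.
HB.instance Definition _ := GRing.RMorphism.on counit.
HB.instance Definition _ := GRing.Linear.on counit.

Lemma counit_var g : counit (var K g) = counit_gen K g.
Proof. by rewrite /counit mmapU mul1r /counit_monom fmU big_seq1. Qed.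

Lemma U_one_neq0 : (1 : U) != 0.
Proof.
have -> : (1 : U) = pres_pi (U_rel r s (@var K)) 1 by rewrite rmorph1.
rewrite -(linear0 (pres_pi _)) span_pi_eq subr0; apply/negP => /spanpP id1.
have c1 : counit 1 = 1 by exact: rmorph1.
have counitZ b x : counit (b *: x) = b * counit x by exact: linearZ.
have counitD x y : counit (x + y) = counit x + counit y by exact: rmorphD.
suff c0 : counit 1 = 0 by have /eqP := oner_neq0 K; rewrite -c1 c0.
elim: id1 => {c1} [_ [a [x [y [b [Rxy ->]]]]]||x y _ IHx _ IHy|a x _ IHx].
- have -> : counit (a * (x - y) * b) =
    counit a * (counit x - counit y) * counit b.
    by rewrite /= !rmorphM rmorphB.
  by rewrite (counit_rel counitZ counit_var Rxy) subrr mulr0 mul0r.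
- exact: (raddf0 counit).
- by rewrite counitD IHx IHy addr0.
- by rewrite counitZ IHx mulr0.
Qed.

HB.instance Definition _ := GRing.PzSemiRing_isNonZero.Build U U_one_neq0.
HB.instance Definition _ :=
  GRing.Lmodule_isLalgebra.Build K U (@pres_scaleAl _ _ (U_rel r s (@var K))).
HB.instance Definition _ :=
  GRing.Lalgebra_isAlgebra.Build K U (@pres_scaleAr _ _ (U_rel r s (@var K))).

Definition U_gen (g : gen) : U := pres_pi (U_rel r s (@var K)) (var K g).

Definition Uplus_gens : U -> Prop := fun x => exists i, x = U_gen (Ge i).
Definition Uminus_gens : U -> Prop := fun x => exists i, x = U_gen (Gf i).
Definition Uzero_gens : U -> Prop := fun x => exists2 g, is_w g & x = U_gen g.

Definition Uplus : Type := subalg Uplus_gens.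
HB.instance Definition _ := GRing.Algebra.on Uplus.
Definition Uminus : Type := subalg Uminus_gens.
HB.instance Definition _ := GRing.Algebra.on Uminus.
Definition Uzero : Type := subalg Uzero_gens.
HB.instance Definition _ := GRing.Algebra.on Uzero.

Definition triangular_mul : tensor (tensor Uminus Uzero) Uplus -> U :=
  @mult_map _ _ Uminus_gens Uzero_gens Uplus_gens.
HB.instance Definition _ := GRing.Linear.on triangular_mul.

End QuantumGroup.

(* Main.v *)
Require Import Defs.
From HB Require Import structures.
From mathcomp Require Import all_boot all_order all_algebra.
From mathcomp Require Import finmap boolp ring.
From mathcomp.multinomials Require mpoly.
From mathcomp.multinomials Require Import monalg.

Set Implicit Arguments.
Unset Strict Implicit.
Unset Printing Implicit Defensive.

Import GRing.Theory Num.Theory.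
Local Open Scope ring_scope.

(** The triangular decomposition is proved by letting the algebra act on the
    space that its decomposition predicts.  Over a field containing nonzero
    scalars r and s, start from the free vector space on triples (x, c, y),
    where x is a word in the f_i, c a word in the w_i, w'_i and their inverses,
    and y a word in the e_i; the triple stands for the product x c y.  On this
    space f_i prepends a letter to x, each w-generator is moved past x at the
    cost of a scalar and prepended to c, and e_i is defined by recursion on x so
    that the relation e_i f_j - f_j e_i = delta_ij (w_i - w'_i) / (r - s) holds
    by construction; for x empty it passes c at the cost of a scalar and is
    prepended to y.

    The remaining relations are imposed by a quotient: one kills x S x' c y for
    S a Serre or far-commutation expression in the f's, and x m for m obtained
    by inserting in the middle word a relation between w-generators, or in the
    right word a Serre expression in the e's.  The point is that all operators
    descend to this quotient and satisfy there every defining relation of U.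
    Both facts rest on one computation ([serre_skew], [serre_op_comm]): a Serre
    expression in the e's commutes with every f_k and one in the f's commutes
    with every e_k.  The second commutation makes the killed subspace stable
    under the e_k.  The first shows that a Serre expression in the e's, which
    vanishes on triples with x empty, vanishes everywhere, because the f's
    generate the quotient from those triples.

    So U acts on the quotient ([act_rel], [act_pi]).  Sending a triple to the
    tensor of its three words in the subalgebras of f's, w's and e's respects
    the quotient ([tens_word_relator]), so that an element of U can be applied
    to the empty triple and then read as a tensor.  This map [mult_inv] is a
    two-sided inverse of multiplication.  On a product of words x c y it returns
    the tensor of x, c and y, and such tensors span ([mult_inv_mu]).
    Conversely, multiplying out the tensor attached to a vector intertwines the
    action with left multiplication in U ([value_act]), which gives the other
    composite ([mu_mult_inv]). *)

(** * Linear maps and induction on free modules, quotients and tensors *)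

Section LinearExtension.
Variables (K : fieldType) (B : choiceType).

Lemma malg_linear_ind (P : {malg K[B]} -> Prop) :
    P 0 -> (forall a x y, P x -> P y -> P (a *: x + y)) ->
    (forall b, P << b >>) ->
  forall x, P x.
Proof.
move=> P0 PL Pb x; rewrite [x]monalgE; elim: (enum_fset _) => [|b s IHs].
  by rewrite big_nil.
rewrite big_cons.
have -> : << x@_b *g b >> = x@_b *: << b >> :> {malg K[B]}.
  apply/malgP => k; rewrite mcoeffZ !mcoeffU.
  by case: eqP; rewrite ?mulr1 ?mulr0.
by apply: PL.
Qed.

Variable V : lmodType K.

Lemma lin_ext_exists (f : B -> V) :
  {g : {linear {malg K[B]} -> V} | forall b, g << b >> = f b}.
Proof.
pose g (x : {malg K[B]}) := \sum_(b <- msupp x) x@_b *: f b.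
have gEw x (d : {fset B}) : (msupp x `<=` d)%fset ->
    g x = \sum_(b <- d) x@_b *: f b.
  move=> le; rewrite [LHS](big_fset_incl _ le) => //= b _ /mcoeff_outdom ->.
  by rewrite scale0r.
have gL : linear g.
  move=> a x y; pose d := (msupp x `|` msupp y `|` msupp (a *: x + y))%fset.
  have xd : (msupp x `<=` d)%fset by rewrite /d -fsetUA fsubsetUl.
  have yd : (msupp y `<=` d)%fset by rewrite /d fsetUAC fsubsetUr.
  have zd : (msupp (a *: x + y) `<=` d)%fset by rewrite /d fsubsetUr.
  rewrite (gEw _ _ xd) (gEw _ _ yd) (gEw _ _ zd).
  rewrite scaler_sumr -big_split; apply: eq_bigr => b _ /=.
  by rewrite mcoeffD mcoeffZ scalerDl scalerA.
pose gM := GRing.isLinear.Build K {malg K[B]} V *:%R g gL.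
pose gl : {linear {malg K[B]} -> V} := HB.pack g gM.
exists gl => b.
by rewrite /= (gEw _ _ msuppU_le) big_seq_fset1 mcoeffUU scale1r.
Qed.

Definition lin_ext (f : B -> V) : {linear {malg K[B]} -> V} :=
  sval (lin_ext_exists f).

Lemma lin_extU f b : lin_ext f << b >> = f b.
Proof. exact: (svalP (lin_ext_exists f)). Qed.

End LinearExtension.

Section TensorFacts.
Variables (K : fieldType) (V W : lmodType K).

Lemma span_pi_gen (Z : lmodType K) (S : Z -> Prop) x : S x -> span_pi S x = 0.
Proof.
move=> Sx; rewrite -(linear0 (span_pi S)); apply/eqP.
by rewrite span_pi_eq subr0; apply/spanpP/in_span_gen.
Qed.

Lemma span_pi_eq0 (Z : lmodType K) (S : Z -> Prop) x :
  span_pi S x = 0 -> in_span S x.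
Proof.
move=> x0; apply/spanpP; rewrite -[x]subr0 -span_pi_eq x0.
by rewrite (linear0 (span_pi S)).
Qed.

Lemma tensPl (w : W) a (v v' : V) :
  tens (a *: v + v') w = a *: tens v w + tens v' w.
Proof.
have /eqP := span_pi_gen (tensor_relDl (a *: v) v' w).
rewrite 2!linearB -addrA -opprD subr_eq0 => /eqP tD.
have /eqP := span_pi_gen (tensor_relZl a v w).
by rewrite linearB linearZ subr_eq0 => /eqP tZ; rewrite /tens tD tZ.
Qed.

Lemma tensPr (v : V) a (w w' : W) :
  tens v (a *: w + w') = a *: tens v w + tens v w'.
Proof.
have /eqP := span_pi_gen (tensor_relDr v (a *: w) w').
rewrite 2!linearB -addrA -opprD subr_eq0 => /eqP tD.
have /eqP := span_pi_gen (tensor_relZr a v w).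
by rewrite linearB linearZ subr_eq0 => /eqP tZ; rewrite /tens tD tZ.
Qed.

Lemma tens_bilinear : bilinear_for *:%R *:%R (@tens K V W).
Proof. by split=> [w|v] a x y; rewrite /= ?tensPl ?tensPr. Qed.

HB.instance Definition _ := bilinear_isBilinear.Build K
  V W (tensor V W) *:%R *:%R (@tens K V W) tens_bilinear.

Lemma tensor_linear_ind (P : tensor V W -> Prop) :
    P 0 -> (forall a x y, P x -> P y -> P (a *: x + y)) ->
    (forall v w, P (tens v w)) ->
  forall x, P x.
Proof.
move=> P0 PL Pt x; rewrite -[x]span_piK; move: (repr x).
apply: malg_linear_ind => [|a y z Py Pz|[v w]]; last exact: Pt.
  by rewrite linear0.
by rewrite linearP; apply: PL.
Qed.

End TensorFacts.

Section SubalgebraWords.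
Variables (K : fieldType) (A : algType K) (S : A -> Prop) (I : Type).
Variable u : I -> subalg S.
Hypothesis uS : forall x, S x -> exists i, x = val (u i).

(** The span of the words is closed under products, hence is the whole
    subalgebra; linear statements need only be checked on words. *)
Lemma subalg_words_ind (P : subalg S -> Prop) :
    P 0 -> (forall a x y, P x -> P y -> P (a *: x + y)) ->
    (forall s : seq I, P (\prod_(i <- s) u i)) ->
  forall x, P x.
Proof.
move=> P0 PL Pw x.
suff : in_span (fun z => exists s : seq I, z = \prod_(i <- s) u i) x.
  elim=> {x} [_ [s ->]|//|x y _ Px _ Py|a x _ Px]; first exact: Pw.
    by rewrite -[x]scale1r; apply: PL.
  by rewrite -[_ *: _]addr0; apply: PL.
suff [y yx ys] : exists2 y : subalg S, val y = val x &
    in_span (fun z => exists s : seq I, z = \prod_(i <- s) u i) y.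
  by rewrite -(val_inj yx).
have /subalgpP := valP x; move: (val x) => {x} z0.
elim=> [x /uS[i ->]||x y _ [x' <- xs] _ [y' <- ys]|a x _ [x' <- xs]
       |x y _ [x' <- xs] _ [y' <- ys]].
- by exists (u i) => //; apply: in_span_gen; exists [:: i]; rewrite big_seq1.
- by exists 1 => //; apply: in_span_gen; exists [::]; rewrite big_nil.
- by exists (x' + y') => //; apply: in_spanD.
- by exists (a *: x'); [rewrite linearZ|apply: in_spanZ].
exists (x' * y') => //; elim: xs => [_ [s ->]||z t _ IHz _ IHt|a z _ IHz].
- elim: ys => [_ [t ->]||z v _ IHz _ IHv|a z _ IHz].
  + by apply: in_span_gen; exists (s ++ t); rewrite big_cat.
  + by rewrite mulr0; apply: in_span0.
  + by rewrite mulrDr; apply: in_spanD.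
  + by rewrite -scalerAr; apply: in_spanZ.
- by rewrite mul0r; apply: in_span0.
- by rewrite mulrDl; apply: in_spanD.
- by rewrite -scalerAl; apply: in_spanZ.
Qed.

End SubalgebraWords.

Section QuotientLift.
Variables (K : fieldType) (V Z : lmodType K) (S : V -> Prop).
Variable f : {linear V -> Z}.

Lemma linear_span_eq0 : (forall x, S x -> f x = 0) ->
  forall x, in_span S x -> f x = 0.
Proof.
move=> fS x; elim=> {x} [//||x y _ fx _ fy|a x _ fx]; first exact: linear0.
  by rewrite linearD fx fy addr0.
by rewrite linearZ /= fx scaler0.
Qed.

Lemma quot_lift_exists : (forall x, S x -> f x = 0) ->
  {g : {linear span_quot S -> Z} | forall x, g (span_pi S x) = f x}.
Proof.
move=> fS; pose g (q : span_quot S) := f (repr q).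
have gE x : g (span_pi S x) = f x.
  apply/eqP; rewrite -subr_eq0 /g -linearB; apply/eqP.
  by apply: linear_span_eq0 => //; apply/spanpP; rewrite -span_pi_eq span_piK.
have gL : linear g.
  by move=> a p q; rewrite -[p]span_piK -[q]span_piK -linearP !gE linearP.
pose gM := GRing.isLinear.Build K (span_quot S) Z *:%R g gL.
pose gl : {linear span_quot S -> Z} := HB.pack g gM.
by exists gl.
Qed.

Definition quot_lift (fS : forall x, S x -> f x = 0) :
  {linear span_quot S -> Z} := sval (quot_lift_exists fS).

Lemma quot_liftE fS x : quot_lift fS (span_pi S x) = f x.
Proof. exact: (svalP (quot_lift_exists fS)). Qed.

End QuotientLift.

(** * Serre expressions and the operators that commute with them *)

Section SerreWords.
Variables (K : fieldType) (a b : K).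

(** A noncommutative polynomial is encoded as a list of coefficients and words
    of indices.  The two quantum Serre relations, for the e's and for the f's,
    differ only in the scalars a and b. *)
Inductive serre : seq (K * seq nat) -> Prop :=
  | serre_comm i j of 1 < `|i%:Z - j%:Z| :
      serre [:: (1, [:: i; j]); (-1, [:: j; i])]
  | serre_left i :
      serre [:: (1, [:: i; i; i.+1]); (- a, [:: i; i.+1; i]);
                (b, [:: i.+1; i; i])]
  | serre_right i :
      serre [:: (1, [:: i; i.+1; i.+1]); (- a, [:: i.+1; i; i.+1]);
                (b, [:: i.+1; i.+1; i])].

(** The words of one expression are anagrams of each other, so a scalar that
    depends only on the letters of a word factors out of the expression. *)
Lemma serre_homogeneous L : serre L ->
  exists u, forall t, t \in L -> perm_eq t.2 u.
Proof.
have catC (s t : seq nat) : perm_eq (s ++ t) (t ++ s) by rewrite perm_catC.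
case=> [i j _|i|i].
- exists [:: i; j] => t; rewrite !inE => /orP[] /eqP-> //.
  exact: (catC [:: j] [:: i]).
- exists [:: i; i; i.+1] => t; rewrite !inE => /or3P[] /eqP-> //.
    by rewrite perm_cons; exact: (catC [:: i.+1] [:: i]).
  exact: (catC [:: i.+1] [:: i; i]).
- exists [:: i; i.+1; i.+1] => t; rewrite !inE => /or3P[] /eqP-> //.
    exact: (catC [:: i.+1] [:: i; i.+1]).
  exact: (catC [:: i.+1; i.+1] [:: i]).
Qed.

(** These are the coefficients that arise in the commutator of a Serre
    expression with an operator Z for which [Z, X_j] is zero unless j = k,
    [Z, X_k] is proportional to A - B, and A X_j = p_j X_j A, and similarly for
    B with weights of its own.  The fields with a prime concern the
    neighbour k - 1 instead of k + 1; the fields sum and prod come from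
    expressions in which k is the repeated index, the fields root from those in
    which it occurs once. *)
Record serre_weight (k : nat) (p : nat -> K) : Prop := SerreWeight {
  sw_far j : 1 < `|k%:Z - j%:Z| -> p j = 1;
  sw_sum : p k.+1 * (p k + 1) = a;
  sw_prod : a * (p k * p k.+1) = b * (p k + 1);
  sw_root : b - a * p k.+1 + p k.+1 ^+ 2 = 0;
  sw_sum' i : k = i.+1 -> b * (p i * (p k + 1)) = a;
  sw_prod' i : k = i.+1 -> a * (p k * p i) = p k + 1;
  sw_root' i : k = i.+1 -> 1 - a * p i + b * p i ^+ 2 = 0 }.

Variables (V : lmodType K) (X : nat -> {linear V -> V}).

Definition opw (u : seq nat) (m : V) : V := foldr (fun i => X i) m u.

Lemma opw_linear u : linear (opw u).
Proof. by elim: u => [//|i u IHu] c x y; rewrite /= IHu linearP. Qed.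

HB.instance Definition _ u :=
  GRing.isLinear.Build K V V *:%R (opw u) (opw_linear u).

Lemma opw_cat u v m : opw (u ++ v) m = opw u (opw v m).
Proof. exact: foldr_cat. Qed.

Section Commutation.
Variables (k : nat) (A : {linear V -> V}) (p : nat -> K).
Hypothesis AX : forall j m, A (X j m) = p j *: X j (A m).

(** The skew derivation that replaces, one at a time, each letter k of a word by
    the operator A; it is the A-part of the commutator with Z. *)
Fixpoint skew (u : seq nat) (m : V) : V :=
  if u is j :: u' then
    X j (skew u' m) + (if j == k then A (opw u' m) else 0)
  else 0.

(** Moving A to the right turns the sum into a combination of at most two words
    ending in A, whose coefficients are those of [serre_weight]. *)
Lemma serre_skew L m : serre_weight k p -> serre L ->
  \sum_(t <- L) t.1 *: skew t.2 m = 0.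
Proof.
move=> [far sum prod root sum' prod' root'].
have X0 j : X j 0 = 0 by exact: linear0.
have XD j x y : X j (x + y) = X j x + X j y by exact: linearD.
have XZ j c x : X j (c *: x) = c *: X j x by exact: linearZ_LR.
pose zE := (addr0, add0r, scaler0); pose XE := (X0, AX, XZ, XD).
have nS i : (i == i.+1) = false by rewrite ltn_eqF.
have Sn i : (i.+1 == i) = false by rewrite gtn_eqF.
case=> [i j ij|i|i]; rewrite !big_cons big_nil addr0 scale1r.
- rewrite scaleN1r /= !X0.
  have [ik|_] := eqVneq i k; have [jk|_] := eqVneq j k.
  + by rewrite ik jk subrr.
  + by rewrite !zE X0 AX far ?scale1r ?zE ?subrr // -ik.
  + by rewrite !zE X0 AX far ?scale1r ?zE ?subrr // -jk distrC.
  + by rewrite !zE !X0 subrr.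
- have [ik|ik] := eqVneq i k.
    rewrite -ik in sum prod *.
    have -> : skew [:: i; i; i.+1] m = a *: X i (X i.+1 (A m)).
      rewrite /= -ik eqxx Sn !(XE, zE) !scalerA -scalerDl -sum.
      by congr (_ *: _); ring.
    have -> : skew [:: i; i.+1; i] m =
        X i (X i.+1 (A m)) + (p i * p i.+1) *: X i.+1 (X i (A m)).
      by rewrite /= -ik eqxx Sn !(XE, zE) !scalerA mulrC.
    have -> : skew [:: i.+1; i; i] m = (p i + 1) *: X i.+1 (X i (A m)).
      by rewrite /= -ik eqxx Sn !(XE, zE) scalerDl scale1r addrC.
    rewrite /= scalerDr scaleNr !scalerA mulNr prod scaleNr subrK.
    by rewrite subrr.
  have [Sik|Sik] := eqVneq i.+1 k; last first.
    by rewrite /= (negbTE ik) (negbTE Sik) !(XE, zE).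
  rewrite /= (negbTE ik) Sik eqxx !(XE, zE) !scalerA -[X in X + _]scale1r.
  rewrite -!scalerDl -[RHS](scale0r (X i (X i (A m)))) -(root' i) //.
  by congr (_ *: _); ring.
- have [ik|ik] := eqVneq i k.
    rewrite /= ik eqxx Sn !(XE, zE) !scalerA -!scalerDl.
    rewrite -[RHS](scale0r (X k.+1 (X k.+1 (A m)))) -root.
    by congr (_ *: _); ring.
  have [Sik|Sik] := eqVneq i.+1 k; last first.
    by rewrite /= (negbTE ik) (negbTE Sik) !(XE, zE).
  have {}prod' := prod' i (esym Sik); have {}sum' := sum' i (esym Sik).
  have -> : skew [:: i; i.+1; i.+1] m = (p k + 1) *: X i (X k (A m)).
    rewrite /= (negbTE ik) Sik eqxx !(XE, zE).
    by rewrite scalerDl scale1r addrC.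
  have -> : skew [:: i.+1; i; i.+1] m =
      X k (X i (A m)) + (p k * p i) *: X i (X k (A m)).
    by rewrite /= (negbTE ik) Sik eqxx !(XE, zE) !scalerA mulrC.
  have -> : b *: skew [:: i.+1; i.+1; i] m = a *: X k (X i (A m)).
    rewrite /= (negbTE ik) Sik eqxx !(XE, zE) !scalerA -scalerDl scalerA.
    by rewrite -sum'; congr (_ *: _); ring.
  rewrite /= scalerDr scaleNr scalerA mulNr prod' scaleNr.
  by rewrite [X in _ + X]addrAC addNr add0r subrr.
Qed.

End Commutation.

Definition serre_op (L : seq (K * seq nat)) (m : V) : V :=
  \sum_(t <- L) t.1 *: opw t.2 m.

Lemma serre_op_linear L : linear (serre_op L).
Proof.
move=> c x y; rewrite /serre_op scaler_sumr -big_split.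
apply: eq_bigr => t _ /=.
by rewrite linearP scalerDr !scalerA mulrC.
Qed.

HB.instance Definition _ L :=
  GRing.isLinear.Build K V V *:%R (serre_op L) (serre_op_linear L).

(** The commutator of Z with a Serre expression is the difference of its skew
    derivations along A and B, and both vanish. *)
Lemma serre_op_comm k c (Z A B : {linear V -> V}) (p q : nat -> K) L m :
    (forall j x, A (X j x) = p j *: X j (A x)) ->
    (forall j x, B (X j x) = q j *: X j (B x)) ->
    (forall j x, Z (X j x) =
       X j (Z x) + if j == k then c *: (A x - B x) else 0) ->
    serre_weight k p -> serre_weight k q -> serre L ->
  Z (serre_op L m) = serre_op L (Z m).
Proof.
move=> AX BX ZX pk qk SL.
have ZE u : Z (opw u m) = opw u (Z m) + c *: (skew k A u m - skew k B u m).
  elim: u => [|j u IHu] /=; first by rewrite subrr scaler0 addr0.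
  rewrite ZX IHu linearD linearZ linearB /= -addrA; congr (_ + _).
  case: eqP => _; last by rewrite !addr0.
  by rewrite -scalerDr opprD addrACA.
have S0 : \sum_(t <- L) t.1 *: (skew k A t.2 m - skew k B t.2 m) = 0.
  under eq_bigr do rewrite scalerBr.
  by rewrite sumrB (serre_skew AX m pk SL) (serre_skew BX m qk SL) subrr.
have cS0 := congr1 ( *:%R c) S0; rewrite scaler0 scaler_sumr in cS0.
rewrite /serre_op linear_sum -[RHS]addr0 -[X in _ = _ + X]cS0.
rewrite -big_split; apply: eq_bigr => t _ /=; rewrite linearZ /= ZE scalerDr.
by congr (_ + _); rewrite !scalerA mulrC.
Qed.

Lemma serre_op_scale (A : {linear V -> V}) (p : nat -> K) L :
    (forall j x, A (X j x) = p j *: X j (A x)) -> serre L ->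
  exists c, forall m, A (serre_op L m) = c *: serre_op L (A m).
Proof.
move=> AX /serre_homogeneous[u Lu]; exists (\prod_(j <- u) p j) => m.
have AE v : A (opw v m) = (\prod_(j <- v) p j) *: opw v (A m).
  elim: v => [|j v IHv]; first by rewrite big_nil scale1r.
  by rewrite /= AX IHv linearZ big_cons scalerA.
rewrite /serre_op linear_sum scaler_sumr [LHS]big_seq [RHS]big_seq.
apply: eq_bigr => t /= /Lu tu.
by rewrite linearZ /= AE (perm_big _ tu) !scalerA mulrC.
Qed.

End SerreWords.

(** * The module on triples of words *)

Section FreeModule.
Variables (K : fieldType) (r s : K).
Hypotheses (r0 : r != 0) (s0 : s != 0).

Local Notation form := Defs.form.

Definition wgen := {g : gen | is_w g}.
HB.instance Definition _ := Choice.on wgen.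

Definition word := (seq nat * seq wgen * seq nat)%type.
HB.instance Definition _ := Choice.on word.

Local Notation M := {malg K[word]}.

(** The scalar in w e_j = wt e_j w; the corresponding scalar for f_j is its
    inverse. *)
Definition wt : gen -> nat -> K := locked (fun g j =>
  match g with
  | Ge _ | Gf _ => 1
  | Gw i => r ^ form j i * s ^ (- form i j)
  | Gwi i => (r ^ form j i * s ^ (- form i j))^-1
  | Gw' i => r ^ (- form i j) * s ^ form j i
  | Gwi' i => (r ^ (- form i j) * s ^ form j i)^-1
  end).

Lemma wt_w i j : wt (Gw i) j = r ^ form j i * s ^ (- form i j).
Proof. by rewrite /wt -lock. Qed.

Lemma wt_w' i j : wt (Gw' i) j = r ^ (- form i j) * s ^ form j i.
Proof. by rewrite /wt -lock. Qed.

Lemma wt_neq0 g j : wt g j != 0.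
Proof.
rewrite /wt -lock.
by case: g => i /=; rewrite ?oner_neq0 ?invr_eq0 ?mulf_neq0 // expfz_neq0.
Qed.

Definition wtf (g : wgen) (x : seq nat) : K := \prod_(j <- x) (wt (val g) j)^-1.
Definition wte (i : nat) (c : seq wgen) : K := \prod_(g <- c) (wt (val g) i)^-1.

Definition wgen_w i : wgen := exist _ (Gw i) isT.
Definition wgen_w' i : wgen := exist _ (Gw' i) isT.

Definition opF : nat -> {linear M -> M} :=
  locked (fun i => lin_ext (fun b : word => << (i :: b.1.1, b.1.2, b.2) >>)).

Definition opW : wgen -> {linear M -> M} :=
  locked (fun g => lin_ext (fun b : word =>
    wtf g b.1.1 *: << (b.1.1, g :: b.1.2, b.2) >>)).

Definition opH (i : nat) : {linear M -> M} :=
  (r - s)^-1 \*: (opW (wgen_w i) \- opW (wgen_w' i)).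

(** Imposes e_i f_j = f_j e_i + delta_ij (w_i - w'_i) / (r - s) by recursion on
    the word of f's, and e_i c = wte c e_i on the word of w's. *)
Fixpoint E_word (i : nat) (x : seq nat) (c : seq wgen) (y : seq nat) : M :=
  if x is j :: x' then
    opF j (E_word i x' c y) + if j == i then opH i << (x', c, y) >> else 0
  else wte i c *: << ([::], c, i :: y) >>.

Definition opE : nat -> {linear M -> M} :=
  locked (fun i => lin_ext (fun b : word => E_word i b.1.1 b.1.2 b.2)).

Lemma opFU i x c y : opF i << (x, c, y) >> = << (i :: x, c, y) >>.
Proof. by rewrite /opF -lock lin_extU. Qed.

Lemma opWU g x c y : opW g << (x, c, y) >> = wtf g x *: << (x, g :: c, y) >>.
Proof. by rewrite /opW -lock lin_extU. Qed.

Lemma opEU i x c y : opE i << (x, c, y) >> = E_word i x c y.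
Proof. by rewrite /opE -lock lin_extU. Qed.

Lemma opE_opF i j m :
  opE i (opF j m) = opF j (opE i m) +
    if j == i then (r - s)^-1 *: (opW (wgen_w i) m - opW (wgen_w' i) m) else 0.
Proof.
move: m; apply: malg_linear_ind => [|a x y IHx IHy|[[x c] y]].
- rewrite (linear0 (opF j)) (linear0 (opE i)) (linear0 (opF j)).
  rewrite (linear0 (opW (wgen_w i))) (linear0 (opW (wgen_w' i))).
  by rewrite subrr scaler0 if_same addr0.
- rewrite !linearP IHx IHy scalerDr addrACA; congr (_ + _).
  case: eqP => _; last by rewrite scaler0 addr0.
  rewrite scalerA mulrC -scalerA -scalerDr; congr (_ *: _).
  by rewrite addrACA -scalerDr.
- by rewrite opFU !opEU.
Qed.

Lemma opW_opF g j m : opW g (opF j m) = (wt (val g) j)^-1 *: opF j (opW g m).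
Proof.
move: m; apply: malg_linear_ind => [|a x y IHx IHy|[[x c] y]].
- by rewrite !(linear0 (opF j), linear0 (opW g)) scaler0.
- by rewrite !linearP IHx IHy.
- by rewrite opFU !opWU linearZ /= opFU scalerA /wtf big_cons.
Qed.

Lemma form_far i j : 1 < `|i%:Z - j%:Z| -> form i j = 0.
Proof.
rewrite /form; case: eqP => [->|_]; first by rewrite subrr.
case: eqP => [-> ij|//]; exfalso; move: ij.
by rewrite -addn1 PoszD opprD addrA subrr add0r normrN.
Qed.

Lemma form_id i : form i i = 1.
Proof. by rewrite /form eqxx. Qed.

Lemma formS i : form i i.+1 = -1.
Proof. by rewrite /form eqxx ltn_eqF. Qed.

Lemma form_pred i : form i.+1 i = 0.
Proof. by rewrite /form gtn_eqF // ltn_eqF // ltnW. Qed.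

Lemma wt_self k : wt (Gw k) k = r / s /\ wt (Gw' k) k = s / r.
Proof. by rewrite wt_w wt_w' form_id !expr1z !exprN1 [_^-1 * _]mulrC. Qed.

Lemma wt_succ k : wt (Gw k) k.+1 = s /\ wt (Gw' k) k.+1 = r.
Proof.
by rewrite wt_w wt_w' formS form_pred opprK !expr0z !expr1z mul1r mulr1.
Qed.

Lemma wt_pred k : wt (Gw k.+1) k = r^-1 /\ wt (Gw' k.+1) k = s^-1.
Proof.
by rewrite wt_w wt_w' formS form_pred oppr0 !expr0z !exprN1 mul1r mulr1.
Qed.

Lemma wt_far k j : 1 < `|k%:Z - j%:Z| -> wt (Gw k) j = 1 /\ wt (Gw' k) j = 1.
Proof.
move=> kj; rewrite wt_w wt_w' (form_far kj) form_far 1?distrC //.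
by rewrite oppr0 !expr0z mul1r.
Qed.

(** Here p_k is r/s or s/r, p_(k+1) is s or r, and p_(k-1) is 1/r or 1/s: the
    Serre coefficients r + s and r s are exactly those making the commutators
    with the f's vanish. *)
Lemma serre_weight_e k :
  serre_weight (r + s) (r * s) k (wt (Gw k)) /\
  serre_weight (r + s) (r * s) k (wt (Gw' k)).
Proof.
split; split=> [j /wt_far[]//||||i ->|i ->|i ->].
all: rewrite ?(wt_self _).1 ?(wt_self _).2 ?(wt_succ _).1 ?(wt_succ _).2.
all: rewrite ?(wt_pred _).1 ?(wt_pred _).2.
all: by rewrite ?invrK; field; rewrite ?invr_eq0 ?r0 ?s0.
Qed.

Lemma serre_weight_f k :
  serre_weight (r^-1 + s^-1) (r * s)^-1 k (fun j => (wt (Gw k) j)^-1) /\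
  serre_weight (r^-1 + s^-1) (r * s)^-1 k (fun j => (wt (Gw' k) j)^-1).
Proof.
split; split=> [j /wt_far[w1 w1']||||i ->|i ->|i ->].
all: rewrite ?w1 ?w1' ?invr1 //.
all: rewrite ?(wt_self _).1 ?(wt_self _).2 ?(wt_succ _).1 ?(wt_succ _).2.
all: rewrite ?(wt_pred _).1 ?(wt_pred _).2.
all: by rewrite ?invrK; field; rewrite ?invr_eq0 ?r0 ?s0.
Qed.

Definition winv (g : gen) : gen :=
  match g with
  | Gw i => Gwi i | Gwi i => Gw i | Gw' i => Gwi' i | Gwi' i => Gw' i
  | Ge i => Ge i | Gf i => Gf i
  end.

Lemma wt_winv (g : wgen) j : wt (winv (val g)) j = (wt (val g) j)^-1.
Proof. by rewrite /wt -lock; case: g => [[]] //= i _; rewrite invrK. Qed.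

Inductive wrel : seq wgen -> seq wgen -> Prop :=
  | wrel_comm g h : wrel [:: g; h] [:: h; g]
  | wrel_inv g h of val h = winv (val g) : wrel [:: g; h] [::].

Lemma wte_cat i c d : wte i (c ++ d) = wte i c * wte i d.
Proof. exact: big_cat. Qed.

Lemma wte_wrel i u v : wrel u v -> wte i u = wte i v.
Proof.
case=> [g h|g h gh]; rewrite /wte !big_cons !big_nil !mulr1 1?mulrC //.
by rewrite gh wt_winv invrK mulfV ?wt_neq0.
Qed.

Definition base : seq wgen -> seq nat -> M :=
  locked (fun c y => << ([::], c, y) >>).

Lemma baseE c y : base c y = << ([::], c, y) >>.
Proof. by rewrite /base -lock. Qed.

(** The closure under f is built in, closure under w and e is a theorem.  The
    words of w's and e's are varied only in triples without f, where w and e act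
    by prepending a letter up to a scalar. *)
Inductive relator : M -> Prop :=
  | relator_F i m of relator m : relator (opF i m)
  | relator_f L m of serre (r^-1 + s^-1) (r * s)^-1 L :
      relator (serre_op opF L m)
  | relator_w u v c d y of wrel u v :
      relator (base (c ++ u ++ d) y - base (c ++ v ++ d) y)
  | relator_e L c y z of serre (r + s) (r * s) L :
      relator (\sum_(t <- L) t.1 *: base c (y ++ t.2 ++ z)).

Definition Umod := span_quot relator.
HB.instance Definition _ := GRing.Lmodule.on Umod.
Local Notation pi_mod := (span_pi relator).

Lemma pi_mod_scale0 a m : pi_mod m = 0 -> pi_mod (a *: m) = 0.
Proof. by move=> m0; rewrite linearZ /= m0 scaler0. Qed.

Lemma opF_relator i m : relator m -> pi_mod (opF i m) = 0.
Proof. by move=> Rm; apply/span_pi_gen/relator_F. Qed.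

Lemma opF_pi_mod0 i m : pi_mod m = 0 -> pi_mod (opF i m) = 0.
Proof.
move=> /span_pi_eq0.
by apply: (@linear_span_eq0 _ _ _ _ (pi_mod \o opF i)) => x; apply: opF_relator.
Qed.

Lemma opW_base g c y : opW g (base c y) = base (g :: c) y.
Proof. by rewrite !baseE opWU /wtf big_nil scale1r. Qed.

Lemma opE_base i c y : opE i (base c y) = wte i c *: base c (i :: y).
Proof. by rewrite !baseE opEU. Qed.

Lemma opW_relator g m : relator m -> pi_mod (opW g m) = 0.
Proof.
elim=> {m} [i m Rm IHm|L m SL|u v c d y uv|L c y z SL].
- by rewrite opW_opF; apply/pi_mod_scale0/opF_pi_mod0.
- have [a ->] := serre_op_scale (@opW_opF g) SL.
  by apply/pi_mod_scale0/span_pi_gen/relator_f.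
- by rewrite linearB /= !opW_base; apply/span_pi_gen/(relator_w (g :: c)).
- rewrite linear_sum; under eq_bigr do rewrite linearZ /= opW_base.
  exact/span_pi_gen/relator_e.
Qed.

(** The Serre expressions in the f's are handled by their commutation with e_i;
    the relators in the other two words are mapped by e_i to multiples of
    relators of the same kind. *)
Lemma opE_relator i m : relator m -> pi_mod (opE i m) = 0.
Proof.
elim=> {m} [j m Rm IHm|L m SL|u v c d y uv|L c y z SL].
- rewrite opE_opF linearD /= opF_pi_mod0 // add0r.
  case: eqP => _; last exact: linear0.
  by rewrite linearZ /= linearB /= !opW_relator // subrr scaler0.
- have [wk wk'] := serre_weight_f i.
  have -> := serre_op_comm m (@opW_opF (wgen_w i)) (@opW_opF (wgen_w' i))
    (@opE_opF i) wk wk' SL.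
  exact/span_pi_gen/relator_f.
- rewrite linearB /= !opE_base !wte_cat (wte_wrel _ uv) -scalerBr.
  exact/pi_mod_scale0/span_pi_gen/relator_w.
- rewrite linear_sum /=.
  under eq_bigr do rewrite linearZ /= opE_base scalerA mulrC -scalerA.
  rewrite -scaler_sumr.
  exact/pi_mod_scale0/span_pi_gen/(relator_e _ (i :: y)).
Qed.

Definition actF i : {linear Umod -> Umod} :=
  quot_lift (f := pi_mod \o opF i) (@opF_relator i).
Definition actW g : {linear Umod -> Umod} :=
  quot_lift (f := pi_mod \o opW g) (@opW_relator g).
Definition actE i : {linear Umod -> Umod} :=
  quot_lift (f := pi_mod \o opE i) (@opE_relator i).

Lemma actF_pi i m : actF i (pi_mod m) = pi_mod (opF i m).
Proof. exact: quot_liftE. Qed.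

Lemma actW_pi g m : actW g (pi_mod m) = pi_mod (opW g m).
Proof. exact: quot_liftE. Qed.

Lemma actE_pi i m : actE i (pi_mod m) = pi_mod (opE i m).
Proof. exact: quot_liftE. Qed.

(** The quotient is generated by the f's from the triples without f. *)
Lemma Umod_ind (P : Umod -> Prop) :
    P 0 -> (forall a x y, P x -> P y -> P (a *: x + y)) ->
    (forall c y, P (pi_mod (base c y))) -> (forall i n, P n -> P (actF i n)) ->
  forall n, P n.
Proof.
move=> P0 PL Pb PF n; rewrite -[n]span_piK; move: (repr n).
apply: malg_linear_ind => [|a x y Px Py|[[x c] y]].
- by rewrite linear0.
- by rewrite linearP; apply: PL.
- elim: x => [|i x IHx]; first by rewrite -baseE.
  by rewrite -opFU -actF_pi; apply: PF.
Qed.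

Lemma actE_actF i j n :
  actE i (actF j n) = actF j (actE i n) +
    if j == i then (r - s)^-1 *: (actW (wgen_w i) n - actW (wgen_w' i) n)
    else 0.
Proof.
rewrite -[n]span_piK; move: (repr n) => m.
rewrite actF_pi !actE_pi actF_pi !actW_pi opE_opF linearD; congr (_ + _).
by case: eqP => _; [rewrite linearZ linearB|exact: linear0].
Qed.

Lemma actW_actF g j n :
  actW g (actF j n) = (wt (val g) j)^-1 *: actF j (actW g n).
Proof.
rewrite -[n]span_piK; move: (repr n) => m.
by rewrite actF_pi !actW_pi actF_pi opW_opF linearZ.
Qed.

(** Both words commute with the f's up to the same scalar, so it suffices to
    compare them on triples without f, where the relators identify them. *)
Lemma actW_wrel u v n : wrel u v ->
  foldr (fun g => actW g) n u = foldr (fun g => actW g) n v.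
Proof.
move=> uv.
pose Wu u : Umod -> Umod := fun n => foldr (fun g => actW g) n u.
have WuS g w x : Wu (g :: w) x = actW g (Wu w x) by [].
have WuP w a x y : Wu w (a *: x + y) = a *: Wu w x + Wu w y.
  by elim: w => [//|g w IHw]; rewrite !WuS IHw linearP.
have Wu0 w : Wu w 0 = 0.
  by elim: w => [//|g w IHw]; rewrite WuS IHw (linear0 (actW g)).
have Wu_base w c y : Wu w (pi_mod (base c y)) = pi_mod (base (w ++ c) y).
  by elim: w => [//|g w IHw]; rewrite WuS IHw actW_pi opW_base.
have Wu_F w i x : Wu w (actF i x) =
    (\prod_(g <- w) (wt (val g) i)^-1) *: actF i (Wu w x).
  elim: w => [|g w IHw]; first by rewrite big_nil scale1r.
  by rewrite !WuS IHw linearZ /= actW_actF scalerA big_cons mulrC.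
change (Wu u n = Wu v n).
move: n; apply: Umod_ind => [|a x y IHx IHy|c y|i x IHx].
- by rewrite !Wu0.
- by rewrite !WuP IHx IHy.
- rewrite !Wu_base; apply/eqP; rewrite -subr_eq0 -linearB; apply/eqP.
  exact/span_pi_gen/(relator_w [::] c).
- by rewrite !Wu_F IHx -/(wte _ _) -/(wte _ _) (wte_wrel _ uv).
Qed.

Lemma actWC g h n : actW g (actW h n) = actW h (actW g n).
Proof. exact: (actW_wrel n (wrel_comm g h)). Qed.

(** This holds only in the quotient: the recursive term of e_i f_i involves w_i
    and w'_i, with which w commutes only modulo the relators. *)
Lemma actW_actE g i n : actW g (actE i n) = wt (val g) i *: actE i (actW g n).
Proof.
move: n; apply: Umod_ind => [|a x y IHx IHy|c y|j n IHn].
- by rewrite (linear0 (actE i)) (linear0 (actW g)) (linear0 (actE i)) scaler0.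
- by rewrite !linearP IHx IHy.
- rewrite actW_pi actE_pi opW_base actE_pi actW_pi !opE_base.
  rewrite linearZ /= opW_base.
  by rewrite -linearZ scalerA /wte big_cons mulrA mulfV ?mul1r ?wt_neq0.
- rewrite actE_actF linearD /= actW_actF IHn actW_actF !linearZ /=.
  rewrite actE_actF !scalerDr.
  rewrite !scalerA [wt _ i * _]mulrC.
  case: eqP => [->|_]; last by rewrite (linear0 (actW g)) !scaler0.
  rewrite mulVf ?wt_neq0 // !scale1r -!scalerDr linearZ; congr (_ + _).
  rewrite linearB /= [actW g (actW _ n)]actWC.
  by rewrite [actW g (actW (wgen_w' _) n)]actWC.
Qed.

Lemma actF_serre L n :
  serre (r^-1 + s^-1) (r * s)^-1 L -> serre_op actF L n = 0.
Proof.
move=> SL; rewrite -[n]span_piK; move: (repr n) => m.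
have Fw u x : opw actF u (pi_mod x) = pi_mod (opw opF u x).
  by elim: u => [//|i u IHu]; rewrite /= IHu actF_pi.
rewrite -(span_pi_gen (relator_f m SL)) /serre_op linear_sum.
by apply: eq_bigr => t _; rewrite Fw linearZ.
Qed.

(** On triples without f the expression inserts a Serre relator into the word of
    e's; it commutes with the f's, which generate everything else. *)
Lemma actE_serre L n : serre (r + s) (r * s) L -> serre_op actE L n = 0.
Proof.
move=> SL; move: n; apply: Umod_ind => [|a x y IHx IHy|c y|j n IHn].
- exact: linear0.
- by rewrite (serre_op_linear actE L) IHx IHy scaler0 addr0.
- have [u Lu] := serre_homogeneous SL.
  have Ew v : opw actE v (pi_mod (base c y)) =
      (\prod_(i <- v) wte i c) *: pi_mod (base c (v ++ y)).
    elim: v => [|i v IHv]; first by rewrite big_nil scale1r.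
    rewrite /= IHv linearZ /= actE_pi opE_base linearZ /= scalerA.
    by rewrite big_cons mulrC.
  transitivity ((\prod_(i <- u) wte i c) *:
      pi_mod (\sum_(t <- L) t.1 *: base c ([::] ++ t.2 ++ y))).
    rewrite linear_sum scaler_sumr /serre_op [LHS]big_seq [RHS]big_seq.
    apply: eq_bigr => t /= /Lu tu.
    by rewrite Ew (perm_big _ tu) [pi_mod (_ *: _)]linearZ /= !scalerA mulrC.
  by rewrite (span_pi_gen (relator_e c [::] y SL)) scaler0.
- have [wk wk'] := serre_weight_e j.
  have FE i x : actF j (actE i x) = actE i (actF j x) +
      if i == j then - (r - s)^-1 *: (actW (wgen_w j) x - actW (wgen_w' j) x)
      else 0.
    rewrite actE_actF [j == i]eq_sym.
    case: eqP => [->|_]; last by rewrite !addr0.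
    by rewrite scaleNr addrK.
  rewrite -(serre_op_comm n (actW_actE (wgen_w j)) (actW_actE (wgen_w' j)) FE
    wk wk' SL).
  by rewrite IHn linear0.
Qed.

End FreeModule.

(** * The action of the algebra *)

Section SerreSum.
Variables (K : fieldType) (a b : K) (A : algType K) (v : nat -> A).

Definition serre_sum (L : seq (K * seq nat)) : A :=
  \sum_(t <- L) t.1 *: \prod_(i <- t.2) v i.

Lemma serre_sum_comm i j :
  serre_sum [:: (1, [:: i; j]); (-1, [:: j; i])] = v i * v j - v j * v i.
Proof.
by rewrite /serre_sum !big_cons !big_nil /= !mulr1 addr0 scaleN1r scale1r.
Qed.

Lemma serre_sum_left i :
  serre_sum [:: (1, [:: i; i; i.+1]); (- a, [:: i; i.+1; i]);
                (b, [:: i.+1; i; i])] =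
  v i ^+ 2 * v i.+1 - a *: (v i * v i.+1 * v i) + b *: (v i.+1 * v i ^+ 2).
Proof.
rewrite /serre_sum !big_cons !big_nil /= !mulr1 addr0 scaleNr scale1r.
by rewrite !expr2 !mulrA addrA.
Qed.

Lemma serre_sum_right i :
  serre_sum [:: (1, [:: i; i.+1; i.+1]); (- a, [:: i.+1; i; i.+1]);
                (b, [:: i.+1; i.+1; i])] =
  v i * v i.+1 ^+ 2 - a *: (v i.+1 * v i * v i.+1) + b *: (v i.+1 ^+ 2 * v i).
Proof.
rewrite /serre_sum !big_cons !big_nil /= !mulr1 addr0 scaleNr scale1r.
by rewrite !expr2 !mulrA addrA.
Qed.

End SerreSum.

(** The relations are checked for an arbitrary algebra A that acts through
    [gen_op]; the free algebra is the instance used below. *)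
Section Operators.
Local Notation form := Defs.form.
Variables (K : fieldType) (r s : K).
Hypotheses (r0 : r != 0) (s0 : s != 0).

Local Notation N := (Umod r s).
Local Notation F := (actF r s).
Local Notation W := (actW r s).
Local Notation E := (actE r0 s0).

Definition gen_op (g : gen) : {linear N -> N} :=
  match g with
  | Ge i => E i
  | Gf i => F i
  | Gw i => W (exist _ (Gw i) isT)
  | Gwi i => W (exist _ (Gwi i) isT)
  | Gw' i => W (exist _ (Gw' i) isT)
  | Gwi' i => W (exist _ (Gwi' i) isT)
  end.

Lemma gen_opW (g : gen) (wg : is_w g) : gen_op g = W (exist _ g wg).
Proof. by case: g wg => //= i wg; rewrite (eq_irrelevance wg isT). Qed.

Definition word_op (k : seq gen) (n : N) : N := foldr (fun g => gen_op g) n k.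

Lemma word_op_linear k : linear (word_op k).
Proof. by elim: k => [//|g k IHk] a x y; rewrite /= IHk linearP. Qed.

Variables (A : algType K) (X : gen -> A) (act : A -> N -> N).
Hypothesis actPl : forall a x y n,
  act (a *: x + y) n = a *: act x n + act y n.
Hypothesis act1 : forall n, act 1 n = n.
Hypothesis actM : forall x y n, act (x * y) n = act x (act y n).
Hypothesis act_var : forall g n, act (X g) n = gen_op g n.

Let actDl x y n : act (x + y) n = act x n + act y n.
Proof. by rewrite -{1}[x]scale1r actPl scale1r. Qed.

Let act0l n : act 0 n = 0.
Proof. by apply: (addrI (act 0 n)); rewrite -actDl !addr0. Qed.

Let actZl a x n : act (a *: x) n = a *: act x n.
Proof. by rewrite -[a *: x]addr0 actPl act0l addr0. Qed.

Let actBl x y n : act (x - y) n = act x n - act y n.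
Proof. by rewrite actDl -scaleN1r actZl scaleN1r. Qed.

Lemma act_prod (I : Type) (u : I -> gen) (k : seq I) n :
  act (\prod_(i <- k) X (u i)) n = foldr (fun i => gen_op (u i)) n k.
Proof.
elim: k => [|i k IHk]; first by rewrite big_nil act1.
by rewrite big_cons actM act_var IHk.
Qed.

Lemma act_serre (u : nat -> gen) L n :
  act (serre_sum (fun i => X (u i)) L) n = serre_op (fun i => gen_op (u i)) L n.
Proof.
rewrite /serre_sum /serre_op; elim: L => [|t L IHL].
  by rewrite !big_nil act0l.
by rewrite !big_cons actPl IHL act_prod.
Qed.

Lemma act_serre_e L n : serre (r + s) (r * s) L ->
  act (serre_sum (fun i => X (Ge i)) L) n = act 0 n.
Proof. by move=> SL; rewrite act_serre act0l actE_serre. Qed.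

Lemma act_serre_f L n : serre (r^-1 + s^-1) (r * s)^-1 L ->
  act (serre_sum (fun i => X (Gf i)) L) n = act 0 n.
Proof. by move=> SL; rewrite act_serre act0l actF_serre. Qed.

Lemma wt_wV i j :
  r ^ (- form j i) * s ^ form i j = (wt r s (Gw i) j)^-1.
Proof. by rewrite wt_w invfM !invr_expz opprK. Qed.

Lemma wt_w'V i j :
  r ^ form i j * s ^ (- form j i) = (wt r s (Gw' i) j)^-1.
Proof. by rewrite wt_w' invfM !invr_expz opprK. Qed.

Lemma act_rel x y n : U_rel r s X x y -> act x n = act y n.
Proof.
case=> {x y} [g h wg wh|i|i|i|i|i j|i j|i j|i j|i j|i j ij|i j ij|i|i|i|i].
- by rewrite !actM !act_var (gen_opW wg) (gen_opW wh) actWC.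
- by rewrite actM !act_var act1; apply: (actW_wrel r0 s0 n (wrel_inv _)).
- by rewrite actM !act_var act1; apply: (actW_wrel r0 s0 n (wrel_inv _)).
- by rewrite actM !act_var act1; apply: (actW_wrel r0 s0 n (wrel_inv _)).
- by rewrite actM !act_var act1; apply: (actW_wrel r0 s0 n (wrel_inv _)).
- by rewrite actZl !actM !act_var /= actW_actE wt_w.
- by rewrite actZl !actM !act_var /= actW_actE wt_w'.
- by rewrite actZl !actM !act_var /= actW_actF wt_wV.
- by rewrite actZl !actM !act_var /= actW_actF wt_w'V.
- rewrite actBl !actM !act_var /= actE_actF addrAC subrr add0r eq_sym.
  by case: eqP => _; rewrite ?act0l // actZl actBl !act_var.
- have /= <- := serre_sum_comm (fun k => X (Ge k)) i j.
  exact/act_serre_e/serre_comm.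
- have /= <- := serre_sum_comm (fun k => X (Gf k)) i j.
  exact/act_serre_f/serre_comm.
- have /= <- := serre_sum_left (r + s) (r * s) (fun k => X (Ge k)) i.
  exact/act_serre_e/serre_left.
- have /= <- := serre_sum_right (r + s) (r * s) (fun k => X (Ge k)) i.
  exact/act_serre_e/serre_right.
- have /= <- := serre_sum_left (r^-1 + s^-1) (r * s)^-1 (fun k => X (Gf k)) i.
  exact/act_serre_f/serre_left.
- have /= <- := serre_sum_right (r^-1 + s^-1) (r * s)^-1 (fun k => X (Gf k)) i.
  exact/act_serre_f/serre_right.
Qed.

End Operators.

Section Action.
Variables (K : fieldType) (r s : K).
Hypotheses (r0 : r != 0) (s0 : s != 0).

Local Notation N := (Umod r s).
(** Naming the free algebra as an algebra gives all of its operations one and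
    the same structure. *)
Definition free_alg : algType K := free_gen K.
Local Notation FG := (GRing.Algebra.sort free_alg).
Definition gen_var : gen -> FG := var K.
Local Notation X := gen_var.
Local Notation gen_op := (gen_op r0 s0).
Local Notation word_op := (word_op r0 s0).

Definition act : FG -> N -> N :=
  locked (fun x n => lin_ext (fun k : {fmonom gen} => word_op k n) x).

Lemma actU k n : act << k >> n = word_op k n.
Proof. by rewrite /act -lock lin_extU. Qed.

Lemma actPl a x y n : act (a *: x + y) n = a *: act x n + act y n.
Proof. by rewrite /act -lock linearP. Qed.

Lemma act0l n : act 0 n = 0.
Proof. by rewrite /act -lock linear0. Qed.

Lemma actZl a x n : act (a *: x) n = a *: act x n.
Proof. by rewrite -[a *: x]addr0 actPl act0l addr0. Qed.

Lemma actDl x y n : act (x + y) n = act x n + act y n.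
Proof. by rewrite -{1}[x]scale1r actPl scale1r. Qed.

Lemma actBl x y n : act (x - y) n = act x n - act y n.
Proof. by rewrite actDl -scaleN1r actZl scaleN1r. Qed.

Lemma free_alg_ind (P : FG -> Prop) :
    P 0 -> (forall a x y, P x -> P y -> P (a *: x + y)) ->
    (forall k : {fmonom gen}, P << k >>) ->
  forall x, P x.
Proof. exact: malg_linear_ind. Qed.

Lemma actPr x a m n : act x (a *: m + n) = a *: act x m + act x n.
Proof.
elim/free_alg_ind: x => [|b x y IHx IHy|k].
- by rewrite !act0l scaler0 addr0.
- by rewrite !actPl IHx IHy !scalerDr !scalerA addrACA [a * b]mulrC.
- by rewrite !actU word_op_linear.
Qed.

Lemma act0r x : act x 0 = 0.
Proof.
have := actPr x 1 0 0.
rewrite !scale1r addr0 => /eqP; rewrite -subr_eq0 opprD addNKr.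
by rewrite oppr_eq0 => /eqP.
Qed.

Lemma act1 n : act 1 n = n.
Proof. by have := actU (mone : {fmonom gen}) n; rewrite /word_op fm1. Qed.

Lemma actM x y n : act (x * y) n = act x (act y n).
Proof.
elim/free_alg_ind: x => [|a x x' IHx IHx'|k].
- by rewrite mul0r !act0l.
- have -> : (a *: x + x') * y = a *: (x * y) + x' * y :> FG.
    by rewrite mulrDl scalerAl.
  by rewrite !actPl; exact: (congr2 (fun u v => a *: u + v) IHx IHx').
elim/free_alg_ind: y => [|a y y' IHy IHy'|l].
- by rewrite mulr0 !act0l act0r.
- set u : FG := << k >> in IHy IHy' *.
  have -> : u * (a *: y + y') = a *: (u * y) + u * y' :> FG.
    by rewrite mulrDr scalerAr.
  by rewrite !actPl actPr; exact: (congr2 (fun u v => a *: u + v) IHy IHy').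
have -> : << k >> * << l >> = << mmul k l >> :> FG.
  by rewrite malgM_def fgmulUU mulr1.
by rewrite !actU /word_op fmM foldr_cat.
Qed.

Lemma act_var g n : act (X g) n = gen_op g n.
Proof. by rewrite actU /word_op fmU. Qed.

Local Notation piU := (pres_pi (U_rel r s X)).

(** The action factors through U, since the defining ideal acts by zero. *)
Lemma act_pi x y n : piU x = piU y -> act x n = act y n.
Proof.
move=> xy; have : in_span (ideal_gen (U_rel r s X)) (x - y).
  apply: span_pi_eq0; rewrite linearB; apply/eqP.
  by rewrite subr_eq0; apply/eqP.
move=> xy0; apply/eqP; rewrite -subr_eq0 -actBl; apply/eqP.
elim: xy0 n => {x y xy}
  [_ [a [x [y [b [Rxy ->]]]]]||x y _ IHx _ IHy|a x _ IHx] n.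
- rewrite !actM actBl.
  by rewrite (act_rel actPl act1 actM act_var _ Rxy) subrr act0r.
- exact: act0l.
- by rewrite actDl IHx IHy addr0.
- by rewrite actZl IHx scaler0.
Qed.

End Action.

(** * Evaluation of triples in an algebra satisfying the relations *)

Section RelationsInAlgebra.
Variables (K : fieldType) (r s : K).
Hypotheses (r0 : r != 0) (s0 : s != 0).
Variables (B : algType K) (u : gen -> B).
Hypothesis u_rel : forall x y, U_rel r s u x y -> x = y.

Lemma serre_e0 L : serre (r + s) (r * s) L ->
  serre_sum (fun i => u (Ge i)) L = 0.
Proof.
case=> [i j ij|i|i].
- by rewrite serre_sum_comm; apply/u_rel/rel_ee.
- by rewrite serre_sum_left; apply/u_rel/rel_serre_e1.
- by rewrite serre_sum_right; apply/u_rel/rel_serre_e2.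
Qed.

Lemma serre_f0 L : serre (r^-1 + s^-1) (r * s)^-1 L ->
  serre_sum (fun i => u (Gf i)) L = 0.
Proof.
case=> [i j ij|i|i].
- by rewrite serre_sum_comm; apply/u_rel/rel_ff.
- by rewrite serre_sum_left; apply/u_rel/rel_serre_f1.
- by rewrite serre_sum_right; apply/u_rel/rel_serre_f2.
Qed.

Lemma mulKU (g : gen) : is_w g -> u g * u (winv g) = 1.
Proof. by case: g => //= i _; apply: u_rel; constructor. Qed.

Lemma winvK g : winv (winv g) = g. Proof. by case: g. Qed.

Lemma is_w_winv g : is_w (winv g) = is_w g. Proof. by case: g. Qed.

Lemma scale_inv_comm (a b x : B) c : c != 0 -> a * b = 1 -> b * a = 1 ->
  a * x = c *: (x * a) -> b * x = c^-1 *: (x * b).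
Proof.
move=> c0 ab ba ax; apply: (scalerI c0); rewrite scalerA mulfV // scale1r.
have := congr1 (fun z => b * z * b) ax.
rewrite -scalerAr -scalerAl !mulrA ba mul1r => ->.
by rewrite -!mulrA ab mulr1.
Qed.

Lemma w_f_of (g : wgen) j : let a := val g in
  u a * u (Gf j) = (wt r s a j)^-1 *: (u (Gf j) * u a) ->
  u (winv a) * u (Gf j) = (wt r s (winv a) j)^-1 *: (u (Gf j) * u (winv a)).
Proof.
move=> a af; rewrite (wt_winv r s g); apply: scale_inv_comm af.
- by rewrite invr_eq0 wt_neq0.
- exact: (mulKU (valP g)).
- have := @mulKU (winv a); rewrite winvK is_w_winv; apply.
  exact: (valP g).
Qed.

Lemma w_e_of (g : wgen) j : let a := val g in
  u a * u (Ge j) = wt r s a j *: (u (Ge j) * u a) ->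
  u (winv a) * u (Ge j) = wt r s (winv a) j *: (u (Ge j) * u (winv a)).
Proof.
move=> a ae; rewrite (wt_winv r s g); apply: scale_inv_comm ae.
- by rewrite wt_neq0.
- exact: (mulKU (valP g)).
- have := @mulKU (winv a); rewrite winvK is_w_winv; apply.
  exact: (valP g).
Qed.

Lemma w_f (g : wgen) j :
  u (val g) * u (Gf j) = (wt r s (val g) j)^-1 *: (u (Gf j) * u (val g)).
Proof.
have wf i : u (Gw i) * u (Gf j) = (wt r s (Gw i) j)^-1 *: (u (Gf j) * u (Gw i)).
  by rewrite -wt_wV; apply/u_rel/rel_wf.
have w'f i :
    u (Gw' i) * u (Gf j) = (wt r s (Gw' i) j)^-1 *: (u (Gf j) * u (Gw' i)).
  by rewrite -wt_w'V; apply/u_rel/rel_w'f.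
case: g => [[] //= i _]; rewrite ?wf ?w'f //.
  exact: (@w_f_of (exist _ (Gw i) isT) j (wf i)).
exact: (@w_f_of (exist _ (Gw' i) isT) j (w'f i)).
Qed.

Lemma w_e (g : wgen) j :
  u (val g) * u (Ge j) = wt r s (val g) j *: (u (Ge j) * u (val g)).
Proof.
have we i : u (Gw i) * u (Ge j) = wt r s (Gw i) j *: (u (Ge j) * u (Gw i)).
  by rewrite wt_w; apply/u_rel/rel_we.
have w'e i : u (Gw' i) * u (Ge j) = wt r s (Gw' i) j *: (u (Ge j) * u (Gw' i)).
  by rewrite wt_w'; apply/u_rel/rel_w'e.
case: g => [[] //= i _]; rewrite ?we ?w'e //.
  exact: (@w_e_of (exist _ (Gw i) isT) j (we i)).
exact: (@w_e_of (exist _ (Gw' i) isT) j (w'e i)).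
Qed.

Definition w_word (c : seq wgen) : B := \prod_(g <- c) u (val g).

Lemma w_word_wrel c d : wrel c d -> w_word c = w_word d.
Proof.
case=> [[g wg] [h wh]|g h gh]; rewrite /w_word !big_cons !big_nil !mulr1.
  by apply: u_rel; apply: rel_comm.
by rewrite gh mulKU //; case: (g).
Qed.

Lemma e_w_word i c : u (Ge i) * w_word c = wte r s i c *: (w_word c * u (Ge i)).
Proof.
elim: c => [|g c IHc].
  by rewrite /w_word /wte !big_nil mulr1 mul1r scale1r.
have eg :
    u (Ge i) * u (val g) = (wt r s (val g) i)^-1 *: (u (val g) * u (Ge i)).
  by rewrite w_e scalerA mulVf ?scale1r // wt_neq0.
rewrite /w_word /wte !big_cons -/(w_word c) -/(wte r s i c) mulrA eg.
by rewrite -scalerAl -[in LHS]mulrA IHc -scalerAr scalerA mulrA.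
Qed.

Variable value : {linear Umod r s -> B}.
Local Notation pi_mod := (span_pi (relator r s)).
Hypothesis value_actF : forall i n, value (actF r s i n) = u (Gf i) * value n.
Hypothesis value_base : forall c y,
  value (pi_mod (base K c y)) = w_word c * \prod_(i <- y) u (Ge i).

Lemma valueW g n : value (actW r s g n) = u (val g) * value n.
Proof.
move: n; apply: Umod_ind => [|a x y IHx IHy|c y|i n IHn].
- by rewrite (linear0 (actW r s g)) (linear0 value) mulr0.
- by rewrite !linearP IHx IHy mulrDr -scalerAr.
- by rewrite actW_pi opW_base !value_base /w_word big_cons mulrA.
- by rewrite actW_actF linearZ /= !value_actF IHn !mulrA w_f -scalerAl.
Qed.

(** The recursion defining e_i on the module mirrors the commutation of e_i with
    the f's in the algebra. *)
Lemma valueE i n : value (actE r0 s0 i n) = u (Ge i) * value n.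
Proof.
move: n; apply: Umod_ind => [|a x y IHx IHy|c y|j n IHn].
- by rewrite (linear0 (actE r0 s0 i)) (linear0 value) mulr0.
- by rewrite !linearP IHx IHy mulrDr -scalerAr.
- rewrite actE_pi opE_base linearZ /= linearZ /= !value_base big_cons.
  by rewrite [RHS]mulrA e_w_word -scalerAl mulrA.
- rewrite actE_actF linearD /= !value_actF IHn.
  have /u_rel ef : U_rel r s u _ _ := rel_ef _ _ _ i j.
  rewrite !mulrA -[u (Ge i) * _](subrK (u (Gf j) * u (Ge i))) ef.
  rewrite mulrDl [RHS]addrC eq_sym; congr (_ + _).
  case: eqP => _; last by rewrite mul0r linear0.
  by rewrite linearZ linearB /= !valueW -scalerAl mulrBl.
Qed.

Lemma value_gen_op g n : value (gen_op r0 s0 g n) = u g * value n.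
Proof. by case: g => i /=; rewrite ?valueE ?value_actF ?valueW. Qed.

End RelationsInAlgebra.

Section LinearSums.
Variables (K : fieldType) (I : Type) (L : seq I) (c : I -> K).

Lemma linear_sumZ (V Z : lmodType K) (f : {linear V -> Z}) (v : I -> V) :
  f (\sum_(t <- L) c t *: v t) = \sum_(t <- L) c t *: f (v t).
Proof. by rewrite linear_sum; apply: eq_bigr => t _; rewrite linearZ. Qed.

Lemma tens_suml (V Z : lmodType K) (v : I -> V) (z : Z) :
  tens (\sum_(t <- L) c t *: v t) z = \sum_(t <- L) c t *: tens (v t) z.
Proof.
elim: L => [|t l IHl]; first by rewrite !big_nil linear0l.
by rewrite !big_cons tensPl IHl.
Qed.

Lemma tens_sumr (V Z : lmodType K) (v : V) (z : I -> Z) :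
  tens v (\sum_(t <- L) c t *: z t) = \sum_(t <- L) c t *: tens v (z t).
Proof.
elim: L => [|t l IHl]; first by rewrite !big_nil linear0r.
by rewrite !big_cons tensPr IHl.
Qed.

End LinearSums.

(** * From the module to the tensor product *)

Section TensorValues.
Variables (K : fieldType) (r s : K) (V1 V2 V3 : lmodType K).
Variables (p1 : seq nat -> V1) (p2 : seq wgen -> V2) (p3 : seq nat -> V3).
Hypothesis p1_serre : forall L x x', serre (r^-1 + s^-1) (r * s)^-1 L ->
  \sum_(t <- L) t.1 *: p1 (x ++ t.2 ++ x') = 0.
Hypothesis p2_wrel : forall v w c d, wrel v w ->
  p2 (c ++ v ++ d) = p2 (c ++ w ++ d).
Hypothesis p3_serre : forall L y y', serre (r + s) (r * s) L ->
  \sum_(t <- L) t.1 *: p3 (y ++ t.2 ++ y') = 0.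

Local Notation M := {malg K[word]}.
Local Notation T := (tensor (tensor V1 V2) V3).

Definition tens_word : {linear M -> T} := locked (lin_ext (fun b : word =>
  tens (tens (p1 b.1.1) (p2 b.1.2)) (p3 b.2))).

Lemma tens_wordE x c y :
  tens_word << (x, c, y) >> = tens (tens (p1 x) (p2 c)) (p3 y).
Proof. by rewrite /tens_word -lock lin_extU. Qed.

Lemma opw_opF x x' c y :
  opw (@opF K) x << (x', c, y) >> = << (x ++ x', c, y) >>.
Proof. by elim: x => [//|i x IHx]; rewrite /= IHx opFU. Qed.

(** Quantifying over a prefix word x of f's makes the induction go through: a
    relator f_i m prefixed by x is the relator m prefixed by the longer word
    x f_i. *)
Lemma tens_word_relator m x :
  relator r s m -> tens_word (opw (@opF K) x m) = 0.
Proof.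
move=> Rm; elim: Rm x => {m} [i m _ IHm|L m SL|v w c d y vw|L c y z SL] x.
- by have := IHm (x ++ [:: i]); rewrite opw_cat.
- move: m; apply: malg_linear_ind => [|a m m' IHm IHm'|[[x' c] y]].
  + rewrite (linear0 (serre_op _ _)) (linear0 (opw _ _)).
    by rewrite (linear0 tens_word).
  + rewrite (linearP (serre_op _ _)) (linearP (opw _ _)) (linearP tens_word).
    by rewrite IHm IHm' scaler0 addr0.
  rewrite /serre_op (linear_sumZ _ _ (opw _ x)) (linear_sumZ _ _ tens_word).
  under eq_bigr do rewrite /= !opw_opF tens_wordE.
  by rewrite -!tens_suml p1_serre // !linear0l.
- rewrite (linearB (opw (@opF K) x)) (linearB tens_word) /=.
  rewrite (baseE _ (c ++ v ++ d)) (baseE _ (c ++ w ++ d)) !opw_opF.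
  by rewrite !tens_wordE (p2_wrel _ _ vw) subrr.
- rewrite (linear_sumZ _ _ (opw _ x)) (linear_sumZ _ _ tens_word).
  under eq_bigr do rewrite /= baseE opw_opF cats0 tens_wordE.
  by rewrite -tens_sumr p3_serre // linear0r.
Qed.

Lemma tens_word_relator0 m : relator r s m -> tens_word m = 0.
Proof. exact: (@tens_word_relator m [::]). Qed.

Definition tens_value : {linear Umod r s -> T} := quot_lift tens_word_relator0.

Lemma tens_valueE x c y :
  tens_value (span_pi (relator r s) << (x, c, y) >>) =
  tens (tens (p1 x) (p2 c)) (p3 y).
Proof. by rewrite quot_liftE tens_wordE. Qed.

End TensorValues.

Section SerreWordSums.
Variables (K : fieldType) (A : algType K) (v : nat -> A).
Variables (L : seq (K * seq nat)) (x y : seq nat).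

Lemma serre_sum_words : serre_sum v L = 0 ->
  \sum_(t <- L) t.1 *: \prod_(i <- x ++ t.2 ++ y) v i = 0.
Proof.
move=> vL.
transitivity (\prod_(i <- x) v i * serre_sum v L * \prod_(i <- y) v i).
  rewrite /serre_sum mulr_sumr mulr_suml; apply: eq_bigr => t _.
  by rewrite -scalerAr -scalerAl !big_cat /= mulrA.
by rewrite vL mulr0 mul0r.
Qed.

End SerreWordSums.

Section SubalgebraValues.
Variables (K : fieldType) (A : algType K) (S : A -> Prop).

Lemma val_prod (I : Type) (v : I -> subalg S) (k : seq I) :
  val (\prod_(i <- k) v i) = \prod_(i <- k) val (v i).
Proof. exact: (rmorph_prod val). Qed.

Lemma val_serre_sum (v : nat -> subalg S) L :
  val (serre_sum v L) = serre_sum (fun i => val (v i)) L.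
Proof.
have valP a (x y : subalg S) : val (a *: x + y) = a *: val x + val y.
  exact: (linearP val).
rewrite /serre_sum; elim: L => [|t L IHL]; first by rewrite !big_nil.
by rewrite !big_cons valP IHL val_prod.
Qed.

End SubalgebraValues.

Section RelationTransport.
Variables (K : fieldType) (r s : K) (A B : algType K).
Variables (v : gen -> A) (u : gen -> B) (f : A -> B).
Hypothesis fP : forall a x y, f (a *: x + y) = a *: f x + f y.
Hypothesis f1 : f 1 = 1.
Hypothesis fM : forall x y, f (x * y) = f x * f y.
Hypothesis f_v : forall g, f (v g) = u g.
Hypothesis f_rel : forall x y, U_rel r s v x y -> f x = f y.

(** The relations are natural: the images of the generators under an algebra
    morphism satisfy whatever relations it identifies. *)
Lemma rel_transport x y : U_rel r s u x y -> x = y.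
Proof.
have fD a b : f (a + b) = f a + f b by rewrite -{1}[a]scale1r fP scale1r.
have f0 : f 0 = 0 by apply: (addrI (f 0)); rewrite -fD !addr0.
have fZ a b : f (a *: b) = a *: f b by rewrite -[a *: b]addr0 fP f0 addr0.
have fN a : f (- a) = - f a by rewrite -scaleN1r fZ scaleN1r.
pose E := (fD, fN, fM, fZ, f1, f0, f_v).
case=> {x y} [g h wg wh|i|i|i|i|i j|i j|i j|i j|i j|i j ij|i j ij|i|i|i|i].
- by have := f_rel (rel_comm r s v wg wh); rewrite !E.
- by have := f_rel (rel_wwi r s v i); rewrite !E.
- by have := f_rel (rel_wiw r s v i); rewrite !E.
- by have := f_rel (rel_wwi' r s v i); rewrite !E.
- by have := f_rel (rel_wiw' r s v i); rewrite !E.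
- by have := f_rel (rel_we r s v i j); rewrite !E.
- by have := f_rel (rel_w'e r s v i j); rewrite !E.
- by have := f_rel (rel_wf r s v i j); rewrite !E.
- by have := f_rel (rel_w'f r s v i j); rewrite !E.
- by have := f_rel (rel_ef r s v i j); case: eqP => _; rewrite !E.
- by have := f_rel (rel_ee r s v ij); rewrite !E.
- by have := f_rel (rel_ff r s v ij); rewrite !E.
- by have := f_rel (rel_serre_e1 r s v i); rewrite !expr2 !E.
- by have := f_rel (rel_serre_e2 r s v i); rewrite !expr2 !E.
- by have := f_rel (rel_serre_f1 r s v i); rewrite !expr2 !E.
- by have := f_rel (rel_serre_f2 r s v i); rewrite !expr2 !E.
Qed.

End RelationTransport.

Section Decomposition.
Variables (K : fieldType) (r s : K).

Local Notation FG := (GRing.Algebra.sort (free_alg K)).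
Local Notation X := (@gen_var K).
Local Notation A := (U r s).
Local Notation u := (U_gen r s).
Local Notation N := (Umod r s).
Local Notation pi_mod := (span_pi (relator r s)).
Local Notation base := (base K).

Definition piU : FG -> A := pres_pi (U_rel r s X).

Lemma piUP a x y : piU (a *: x + y) = a *: piU x + piU y.
Proof. exact: (linearP (pres_pi (U_rel r s X))). Qed.

Lemma piU0 : piU 0 = 0.
Proof. exact: (linear0 (pres_pi (U_rel r s X))). Qed.

Lemma piU1 : piU 1 = 1.
Proof. exact: (rmorph1 (pres_pi (U_rel r s X))). Qed.

Lemma piUM x y : piU (x * y) = piU x * piU y.
Proof. exact: (rmorphM (pres_pi (U_rel r s X))). Qed.

Lemma piU_X g : piU (X g) = u g.
Proof. by []. Qed.

Lemma piUK (x : A) : piU (repr x) = x.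
Proof. exact: pres_piK. Qed.

Lemma U_gen_rel x y : U_rel r s u x y -> x = y.
Proof.
apply: (@rel_transport K r s (free_alg K) A X u piU piUP piU1 piUM piU_X).
by move=> a b; apply: pres_rel.
Qed.

Lemma fgen_subproof i : u (Gf i) \in subalgp (@Uminus_gens K r s).
Proof. by apply/subalgpP/in_subalg_gen; exists i. Qed.

Lemma egen_subproof i : u (Ge i) \in subalgp (@Uplus_gens K r s).
Proof. by apply/subalgpP/in_subalg_gen; exists i. Qed.

Lemma tgen_subproof (g : wgen) : u (val g) \in subalgp (@Uzero_gens K r s).
Proof. by apply/subalgpP/in_subalg_gen; exists (val g) => //; apply: valP. Qed.

Definition fgen i : Uminus r s := exist _ (u (Gf i)) (fgen_subproof i).
Definition egen i : Uplus r s := exist _ (u (Ge i)) (egen_subproof i).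
Definition tgen g : Uzero r s := exist _ (u (val g)) (tgen_subproof g).

Local Notation T := (tensor (tensor (Uminus r s) (Uzero r s)) (Uplus r s)).
Local Notation mu := (@triangular_mul K r s).

Lemma fgen_serre L : serre (r^-1 + s^-1) (r * s)^-1 L ->
  serre_sum fgen L = 0.
Proof.
move=> SL; apply: val_inj; rewrite val_serre_sum.
exact: (serre_f0 U_gen_rel SL).
Qed.

Lemma egen_serre L : serre (r + s) (r * s) L -> serre_sum egen L = 0.
Proof.
move=> SL; apply: val_inj; rewrite val_serre_sum.
exact: (serre_e0 U_gen_rel SL).
Qed.

Definition fword x : Uminus r s := \prod_(i <- x) fgen i.
Definition tword c : Uzero r s := \prod_(g <- c) tgen g.
Definition eword y : Uplus r s := \prod_(i <- y) egen i.

Lemma fword_serre L x x' : serre (r^-1 + s^-1) (r * s)^-1 L ->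
  \sum_(t <- L) t.1 *: fword (x ++ t.2 ++ x') = 0.
Proof. by move=> SL; apply/serre_sum_words/fgen_serre. Qed.

Lemma tword_wrel v w c d :
  wrel v w -> tword (c ++ v ++ d) = tword (c ++ w ++ d).
Proof.
move=> vw; apply: val_inj; rewrite !val_prod.
have tvw := w_word_wrel U_gen_rel vw.
by rewrite !big_cat /= -[\prod_(_ <- v) _]/(w_word u v) tvw.
Qed.

Lemma eword_serre L y y' : serre (r + s) (r * s) L ->
  \sum_(t <- L) t.1 *: eword (y ++ t.2 ++ y') = 0.
Proof. by move=> SL; apply/serre_sum_words/egen_serre. Qed.

Definition to_tensor : {linear N -> T} :=
  tens_value fword_serre tword_wrel eword_serre.

Lemma to_tensorE x c y : to_tensor (pi_mod << (x, c, y) >>) =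
  tens (tens (fword x) (tword c)) (eword y).
Proof. exact: tens_valueE. Qed.

Lemma muE x h y : mu (tens (tens x h) y) = val x * val h * val y.
Proof. exact: mult_mapE. Qed.

Lemma muP a x y : mu (a *: x + y) = a *: mu x + mu y.
Proof. exact: (linearP mu). Qed.

Definition value : {linear N -> A} := mu \o to_tensor.

Lemma value_pi x c y : value (pi_mod << (x, c, y) >>) =
  (\prod_(i <- x) u (Gf i)) * w_word u c * \prod_(i <- y) u (Ge i).
Proof. by rewrite /= to_tensorE muE !val_prod. Qed.

Lemma value_base c y :
  value (pi_mod (base c y)) = w_word u c * \prod_(i <- y) u (Ge i).
Proof. by rewrite baseE value_pi big_nil mul1r. Qed.

Lemma value_F i n : value (actF r s i n) = u (Gf i) * value n.
Proof.
rewrite -[n]span_piK; move: (repr n).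
apply: malg_linear_ind => [|a m m' IHm IHm'|[[x c] y]].
- by rewrite (linear0 pi_mod) (linear0 (actF r s i)) (linear0 value) mulr0.
- rewrite (linearP pi_mod) (linearP (actF r s i)) !(linearP value).
  by rewrite IHm IHm' mulrDr -scalerAr.
- by rewrite actF_pi opFU !value_pi big_cons !mulrA.
Qed.

Lemma free_alg_words (k : {fmonom gen}) : << k >> = \prod_(g <- k) X g :> FG.
Proof.
have FGM (m1 m2 : {fmonom gen}) : << mmul m1 m2 >> = << m1 >> * << m2 >> :> FG.
  by rewrite malgM_def fgmulUU mulr1.
suff E l : << FMonom l >> = \prod_(g <- l) X g :> FG.
  by rewrite -[in LHS](fmK k); apply: E.
elim: l => [|g l IHl]; first by rewrite big_nil -fmoneE.
by rewrite big_cons -IHl -FGM; congr << _ >>; rewrite [RHS]fmmulE fmU.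
Qed.

End Decomposition.

(** * The inverse of multiplication *)

Section Inverse.
Variables (K : fieldType) (r s : K).
Hypotheses (r0 : r != 0) (s0 : s != 0).

Local Notation FG := (GRing.Algebra.sort (free_alg K)).
Local Notation X := (@gen_var K).
Local Notation A := (U r s).
Local Notation u := (U_gen r s).
Local Notation N := (Umod r s).
Local Notation pi_mod := (span_pi (relator r s)).
Local Notation base := (base K).
Local Notation piU := (@piU K r s).
Local Notation T := (tensor (tensor (Uminus r s) (Uzero r s)) (Uplus r s)).
Local Notation mu := (@triangular_mul K r s).
Local Notation fgen := (fgen r s).
Local Notation egen := (egen r s).
Local Notation tgen := (tgen r s).
Local Notation fword := (fword r s).
Local Notation eword := (eword r s).
Local Notation tword := (tword r s).
Local Notation value := (value r s).
Local Notation to_tensor := (to_tensor r s).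
Local Notation act := (act r0 s0).

(** Reading a vector of the module as an element of U intertwines the action
    with left multiplication. *)
Lemma value_act x n : value (act x n) = piU x * value n.
Proof.
elim/free_alg_ind: x => [|a x y IHx IHy|k].
- by rewrite act0l piU0 (linear0 value) mul0r.
- by rewrite actPl piUP (linearP value) IHx IHy mulrDl -scalerAl.
have valueX g y : value (act (X g * y) n) = u g * value (act y n).
  rewrite actM act_var.
  exact: (value_gen_op r0 s0 (@U_gen_rel K r s) (@value_F K r s)
    (@value_base K r s)).
have piX g y : piU (X g * y) = u g * piU y by rewrite piUM.
have step g y : value (act y n) = piU y * value n ->
    value (act (X g * y) n) = piU (X g * y) * value n.
  by move=> IHy; rewrite (valueX g y) (piX g y) IHy mulrA; reflexivity.
rewrite free_alg_words; elim: (k : seq gen) => [|g l IHl].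
  by rewrite big_nil act1 piU1 mul1r.
by rewrite big_cons; apply: step.
Qed.

Definition vacuum : N := pi_mod (base [::] [::]).

(** The choice of representative in the free algebra is immaterial, by
    [act_pi]. *)
Definition mult_inv (x : A) : T := to_tensor (act (repr x) vacuum).

Lemma mult_invE x : mult_inv (piU x) = to_tensor (act x vacuum).
Proof.
by rewrite /mult_inv; congr (to_tensor _); apply: act_pi; apply: piUK.
Qed.

Lemma mu_mult_inv x : mu (mult_inv x) = x.
Proof.
rewrite -[RHS]piUK -[mu _]/(value _) value_act value_base /w_word !big_nil.
by rewrite !mulr1.
Qed.

Lemma mult_invP a x y : mult_inv (a *: x + y) = a *: mult_inv x + mult_inv y.
Proof.
by rewrite -[x]piUK -[y]piUK -piUP !mult_invE actPl linearP.
Qed.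

Lemma piU_prod (I : Type) (h : I -> gen) (l : seq I) :
  piU (\prod_(i <- l) X (h i)) = \prod_(i <- l) u (h i).
Proof.
elim: l => [|i l IHl]; first by rewrite !big_nil piU1.
by rewrite !big_cons piUM IHl.
Qed.

Lemma act_words (I : Type) (h : I -> gen) (l : seq I) n :
  act (\prod_(i <- l) X (h i)) n = foldr (fun i => gen_op r0 s0 (h i)) n l.
Proof.
exact: (@act_prod K r s r0 s0 (free_alg K) X act (@act1 K r s r0 s0)
  (@actM K r s r0 s0) (@act_var K r s r0 s0)).
Qed.

Lemma act_e_word y :
  act (\prod_(i <- y) X (Ge i)) vacuum = pi_mod (base [::] y).
Proof.
rewrite act_words; elim: y => [//|i y IHy] /=.
by rewrite IHy actE_pi opE_base /wte big_nil scale1r.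
Qed.

Lemma act_w_word c y :
  act (\prod_(g <- c) X (val g)) (pi_mod (base [::] y)) = pi_mod (base c y).
Proof.
rewrite act_words; elim: c => [//|[g wg] c IHc] /=.
by rewrite IHc (gen_opW r0 s0 wg) actW_pi opW_base.
Qed.

Lemma act_f_word x c y :
  act (\prod_(i <- x) X (Gf i)) (pi_mod (base c y)) = pi_mod << (x, c, y) >>.
Proof.
rewrite act_words baseE; elim: x => [//|i x IHx] /=.
by rewrite IHx actF_pi opFU.
Qed.

(** On the vacuum the letters of y, c and x are prepended one after the other,
    with no scalar arising, because e acts before any w or f is present. *)
Lemma mult_inv_words x c y :
  mult_inv (\prod_(i <- x) u (Gf i) * \prod_(g <- c) u (val g) *
       \prod_(i <- y) u (Ge i)) =
  tens (tens (fword x) (tword c)) (eword y).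
Proof.
rewrite -!piU_prod -!piUM mult_invE !actM act_e_word act_w_word act_f_word.
by rewrite to_tensorE.
Qed.

Lemma mult_inv_mu t : mult_inv (mu t) = t.
Proof.
have mult_inv0 : mult_inv 0 = 0.
  by rewrite -(piU0 r s) mult_invE act0l (linear0 to_tensor).
have mu0 : mu 0 = 0 by exact: (linear0 mu).
have step a t1 t2 : mult_inv (mu t1) = t1 -> mult_inv (mu t2) = t2 ->
    mult_inv (mu (a *: t1 + t2)) = a *: t1 + t2.
  move=> e1 e2; rewrite (muP a t1 t2).
  exact: (etrans (mult_invP _ _ _) (congr2 (fun p q => a *: p + q) e1 e2)).
elim/tensor_linear_ind: t => [|a t t' IHt IHt'|t y].
- by rewrite mu0.
- exact: step.
elim/tensor_linear_ind: t => [|a t t' IHt IHt'|x h].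
- by rewrite linear0l mu0.
- by rewrite tensPl; apply: step.
elim/(@subalg_words_ind _ _ _ _ egen): y => [_ [i ->]||a y y' IHy IHy'|y].
- by exists i.
- by rewrite linear0r mu0.
- by rewrite tensPr; apply: step.
elim/(@subalg_words_ind _ _ _ _ tgen): h => [_ [g wg ->]||a h h' IHh IHh'|c].
- by exists (exist _ g wg).
- by rewrite linear0r linear0l mu0.
- by rewrite tensPr tensPl; apply: step.
elim/(@subalg_words_ind _ _ _ _ fgen): x => [_ [i ->]||a x x' IHx IHx'|x].
- by exists i.
- by rewrite !linear0l mu0.
- by rewrite !tensPl; apply: step.
by rewrite muE !val_prod mult_inv_words.
Qed.

End Inverse.

Lemma Qr_neq0 : Qr != 0.
Proof. by rewrite tofrac_eq0 -mpoly.msupp_eq0 mpoly.msuppX. Qed.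

Lemma Qs_neq0 : Qs != 0.
Proof. by rewrite tofrac_eq0 -mpoly.msupp_eq0 mpoly.msuppX. Qed.

Theorem proposition1p2 :
  let mu : {linear tensor (tensor (Uminus Qr Qs) (Uzero Qr Qs)) (Uplus Qr Qs)
                   -> U Qr Qs} := @triangular_mul Qrs Qr Qs in
  (forall (x : Uminus Qr Qs) (h : Uzero Qr Qs) (y : Uplus Qr Qs),
     mu (tens (tens x h) y) = \val x * \val h * \val y) /\
  bijective mu.
Proof.
split; first exact: muE.
exists (mult_inv Qr_neq0 Qs_neq0); first exact: mult_inv_mu.
exact: mu_mult_inv.
Qed.
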